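(* Let $w(z)=w_0+w_1z+\cdots+w_nz^n$ be a polynomial with complex coefficients, and let $T$ be the $(n+1)\times(n+1)$ upper triangular Toeplitz matrix $$T=\begin{bmatrix} w_0&w_1&\cdots&w_n\\ 0&w_0&\cdots&w_{n-1}\\ \vdots&&\ddots&\vdots\\ 0&0&\cdots&w_0\end{bmatrix}.$$ Let $\kappa$ be a nonnegative integer such that $\kappa\le n+1$. (1) If $1-T^*T$ has $\kappa$ negative eigenvalues, then there is a pair $(f,B)$ with $f\in\mathbf S_0$ and $B$ a Blaschke product of degree $\kappa$ such that $B(z)w(z)=f(z)+\mathcal O(z^{n+1})$ (as $z\to0$). (2) If there is a pair $(f,B)$ with $f\in\mathbf S_0$ and $B$ a Blaschke product of degree $\kappa$ such that $B(z)w(z)=f(z)+\mathcal O(z^{n+1})$, then $1-T^*T$ has $\kappa'\le\kappa$ negative eigenvalues.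
   Context: $\mathbf D$ is the open unit disk. $\mathbf S_0$ is the Schur class: holomorphic functions on $\mathbf D$ bounded by one in modulus. A Blaschke product of degree $\kappa$ is a function $B(z)=\gamma\prod_{j=1}^\kappa \frac{z-a_j}{1-z\bar a_j}$ with $|\gamma|=1$ and $a_1,\dots,a_\kappa\in\mathbf D$ not necessarily distinct (for $\kappa=0$, a constant of modulus one). Here $1$ denotes the identity matrix, $T^*$ the conjugate transpose of $T$, and negative eigenvalues are counted with multiplicity. *)

(* Defs.v *)
From mathcomp Require Import all_boot all_order all_algebra spectral complex.
From mathcomp Require Import all_classical all_reals all_analysis.

Set Implicit Arguments.
Unset Strict Implicit.
Unset Printing Implicit Defensive.

Import Order.TTheory GRing.Theory Num.Theory.
Import numFieldNormedType.Exports.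

Local Open Scope ring_scope.

(* [R[i]^o] is the complex plane with the normed-module structure of [R[i]] over
   itself: the norm is the modulus, and [derivable f z 1] is differentiability
   of [f] at [z] in the complex sense.  A function on the open unit disk is
   represented by a total function of which only the values on the disk matter. *)
Definition holomorphic_disk (R : realType) (f : R[i]^o -> R[i]^o) : Prop :=
  forall z : R[i]^o, `|z| < 1 -> derivable f z 1.

Definition schur_class (R : realType) (f : R[i]^o -> R[i]^o) : Prop :=
  holomorphic_disk f /\ forall z : R[i]^o, `|z| < 1 -> `|f z| <= 1.

Definition blaschke_product (R : realType) (kappa : nat)
    (B : R[i]^o -> R[i]^o) : Prop :=
  exists (gamma : R[i]) (a : 'I_kappa -> R[i]),
    [/\ `|gamma| = 1,
        forall j, `|a j| < 1
      & forall z : R[i], `|z| < 1 ->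
          B z = gamma * \prod_(j < kappa) ((z - a j) / (1 - z * (a j)^*))].

Definition toeplitz_upper (K : nzRingType) (n : nat) (w : {poly K}) :
    'M[K]_n.+1 :=
  \matrix_(i < n.+1, j < n.+1) if (i <= j)%N then w`_(j - i) else 0.

(* The eigenvalues of [A], each repeated according to its multiplicity as a
   root of the characteristic polynomial. *)
Definition eigenvalues (K : closedFieldType) (m : nat) (A : 'M[K]_m) : seq K :=
  sval (closed_field_poly_normal (char_poly A)).

(* In the order of [K], [x < 0] holds exactly when [x] is real and negative. *)
Definition num_neg_eigenvalues (K : numClosedFieldType) (m : nat)
    (A : 'M[K]_m) : nat :=
  count (fun x => x < 0) (eigenvalues A).

(* Main.v *)
(** A row vector [x] is read as a polynomial [p]; then [x *m T] is [w * p]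
    modulo [X^(n+1)].  Transposition and the flip exchange [T^* T] and [T T^*],
    so the eigenvalues of [T T^*] can be used instead.  Write [p#] for
    [z^n conj(p(1/conj z))].

    Existence.  Let [c <= 1] be the largest eigenvalue of [T T^*] that is at most
    [1].  Its eigenspace contains [q <> 0] with [w q = sqrt(c) q#] modulo
    [X^(n+1)].  Split [q = q_in q_out], where [q_in] carries the zeros in the open
    disk.  If [q_in] has degree [> kappa], pick [P] of degree [<= kappa] such that
    [x = P q_out] is orthogonal to the [kappa] eigenvectors with eigenvalue
    [> 1]; multiplication by the Blaschke product of [q_in] is a contraction and
    maps [w x] to [sqrt(c) P q_out#], of norm [sqrt(c) |x|], so [x] is again an
    eigenvector for [c].  Either way there is an eigenvector [x] with at most
    [kappa] zeros in the disk.  For [u = w x] one gets [u u# = c x x#], that is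
    [|u| = sqrt(c) |x|] on the circle, and if [B] is the Blaschke product of those
    zeros then [f = B u / x] is a Schur function with [B w = f + O(z^(n+1))].

    Necessity.  If [B w = f + O(z^(n+1))], then [B w p = f p + O(z^(n+1))], and the
    truncation of [f p] has norm at most [|p|].  Truncated multiplication by [B]
    is isometric off [kappa] linear conditions, under which [|w p| <= |p|].  The
    bound on [f p] is Bessel's inequality on circles; it rests on Goursat's
    theorem because [f] is only assumed complex differentiable. *)

Require Import Defs.
From mathcomp Require Import all_boot all_order all_algebra spectral complex.
From mathcomp Require Import all_classical all_reals all_analysis.
From mathcomp Require Import ring lra zify.

Import Order.TTheory GRing.Theory Num.Theory.
Import numFieldNormedType.Exports.

Set Implicit Arguments.
Unset Strict Implicit.
Unset Printing Implicit Defensive.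

Local Open Scope sesquilinear_scope.
Local Open Scope ring_scope.

(** * Polynomials modulo a power of X *)

Section Congruence.
Variable K : comNzRingType.
Implicit Types (p q r : {poly K}) (N : nat).

(** The quotient is kept explicit: evaluating [p = q + h * 'X^N] at a point produces the remainder
    term needed for analytic estimates. *)
Definition eqmodX N p q := exists h, p = q + h * 'X^N.

Lemma eqmodX_refl N p : eqmodX N p p.
Proof. by exists 0; rewrite mul0r addr0. Qed.

Lemma eqmodX_sym N p q : eqmodX N p q -> eqmodX N q p.
Proof. by case=> h ->; exists (- h); rewrite mulNr addrK. Qed.

Lemma eqmodX_trans N q p r : eqmodX N p q -> eqmodX N q r -> eqmodX N p r.
Proof. by case=> h -> [k ->]; exists (k + h); rewrite mulrDl addrA. Qed.

Lemma eqmodXMl N r p q : eqmodX N p q -> eqmodX N (r * p) (r * q).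
Proof. by case=> h ->; exists (r * h); rewrite mulrDr mulrA. Qed.

Lemma eqmodXMr N r p q : eqmodX N p q -> eqmodX N (p * r) (q * r).
Proof. by rewrite ![_ * r]mulrC; apply: eqmodXMl. Qed.

Lemma eqmodXD N p q p' q' :
  eqmodX N p q -> eqmodX N p' q' -> eqmodX N (p + p') (q + q').
Proof. by case=> h -> [k ->]; exists (h + k); rewrite mulrDl addrACA. Qed.

Lemma eqmodX_coef N p q i : eqmodX N p q -> (i < N)%N -> p`_i = q`_i.
Proof. by case=> h -> iN; rewrite coefD coefMXn iN addr0. Qed.

Lemma coef_eqmodX N p q :
  (forall i, (i < N)%N -> p`_i = q`_i) -> eqmodX N p q.
Proof.
move=> pq; exists (drop_poly N p - drop_poly N q).
have eq_take : take_poly N p = take_poly N q.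
  by apply/polyP=> i; rewrite !coef_take_poly; case: ifP => // iN; apply: pq.
rewrite -[LHS](poly_take_drop N) eq_take -[X in _ = X + _](poly_take_drop N q).
by ring.
Qed.

Lemma eqmodX_take N p : eqmodX N p (take_poly N p).
Proof. by apply: coef_eqmodX => i iN; rewrite coef_take_poly iN. Qed.

Lemma geometric_inverse N (c : K) :
  eqmodX N ((1 - c *: 'X) * \sum_(i < N) (c *: 'X) ^+ i) 1.
Proof.
exists (- (c ^+ N)%:P).
have E := subrX1 (c *: 'X) N.
by rewrite -[1 - _]opprB mulNr -E exprZn opprB mulNr mul_polyC.
Qed.

(** The factor [1 - c *: 'X] is a unit modulo [X^N], with the truncated geometric series as
    inverse. *)
Lemma eqmodX_geometricK N (c : K) p q :
  eqmodX N ((1 - c *: 'X) * p) ((1 - c *: 'X) * q) -> eqmodX N p q.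
Proof.
pose h := \sum_(i < N) (c *: 'X) ^+ i.
have hK r : eqmodX N (h * ((1 - c *: 'X) * r)) r.
  rewrite mulrA -[X in eqmodX _ _ X]mul1r; apply: eqmodXMr.
  by rewrite mulrC; apply: geometric_inverse.
move=> /(eqmodXMl h) pq.
exact: eqmodX_trans (eqmodX_trans (eqmodX_sym (hK p)) pq) (hK q).
Qed.

Lemma rVpoly_toeplitz n (g : {poly K}) (x : 'rV[K]_n.+1) :
  eqmodX n.+1 (rVpoly (x *m toeplitz_upper n g)) (g * rVpoly x).
Proof.
apply: coef_eqmodX => k kn; rewrite (_ : k = Ordinal kn :> nat) //.
move: (Ordinal kn) => {k kn} i; rewrite coef_rVpoly_ord mxE coefMr.
rewrite (big_ord_widen_cond n.+1 xpredT (fun j => g`_(i - j) * (rVpoly x)`_j)) //.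
rewrite [RHS]big_mkcond; apply: eq_bigr => j _.
by rewrite !mxE /= ltnS coef_rVpoly_ord; case: ifP; rewrite ?mulr0 // mulrC.
Qed.

End Congruence.

(** * Conjugate reversal of polynomials and the coefficient norm *)

Section Reversal.
Variable C : numClosedFieldType.
Implicit Types (p q r : {poly C}) (n m : nat) (c : C).

(* [revp n p] is [z^n conj(p(1/conj z))], which has the modulus of [p] on the
   unit circle *)
Definition revp n p := \poly_(i < n.+1) (p`_(n - i))^*.

Lemma coef_revp n p i : (revp n p)`_i = if (i <= n)%N then (p`_(n - i))^* else 0.
Proof. by rewrite coef_poly ltnS. Qed.

Lemma size_revp n p : (size (revp n p) <= n.+1)%N.
Proof. exact: size_poly. Qed.

Lemma revpK n p : (size p <= n.+1)%N -> revp n (revp n p) = p.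
Proof.
move=> sp; apply/polyP=> i; rewrite !coef_revp; case: leqP => ni.
  by rewrite leq_subr subKn // conjCK.
by rewrite nth_default // (leq_trans sp).
Qed.

Lemma revpD n p q : revp n (p + q) = revp n p + revp n q.
Proof.
by apply/polyP=> i; rewrite coefD !coef_revp coefD; case: ifP; rewrite ?rmorphD ?addr0.
Qed.

Lemma revp0 n : revp n 0 = 0.
Proof. by apply/polyP=> i; rewrite coef_revp !coef0 rmorph0 if_same. Qed.

Lemma revpZ n c p : revp n (c *: p) = c^* *: revp n p.
Proof.
by apply/polyP=> i; rewrite coefZ !coef_revp coefZ; case: ifP; rewrite ?rmorphM ?mulr0.
Qed.

Lemma revp_sum n (I : Type) (s : seq I) (F : I -> {poly C}) :
  revp n (\sum_(i <- s) F i) = \sum_(i <- s) revp n (F i).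
Proof. exact: (big_morph _ (revpD n) (revp0 n)). Qed.

Lemma revpXn n i : (i <= n)%N -> revp n 'X^i = 'X^(n - i).
Proof.
move=> ni; apply/polyP=> j; rewrite coef_revp !coefXn.
case: leqP => jn; last by have -> : (j == n - i)%N = false by lia.
by rewrite rmorph_nat; congr (_ %:R); lia.
Qed.

Lemma poly_sumX n p : (size p <= n)%N -> p = \sum_(i < n) p`_i *: 'X^i.
Proof.
move=> sp; rewrite -poly_def; apply/polyP=> i; rewrite coef_poly.
by case: ltnP => // ni; rewrite nth_default // (leq_trans sp).
Qed.

(** Both sides are additive and conjugate homogeneous in each factor, so monomials suffice; there
    the exponents are [m - i] and [n - j]. *)
Lemma revpM m n p q : (size p <= m.+1)%N -> (size q <= n.+1)%N ->
  revp (m + n) (p * q) = revp m p * revp n q.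
Proof.
move=> sp sq; rewrite {1}(poly_sumX sp) {1}(poly_sumX sq) big_distrl revp_sum.
rewrite {2}(poly_sumX sp) revp_sum big_distrl /=; apply: eq_bigr => i _.
rewrite {2}(poly_sumX sq) revp_sum !big_distrr revp_sum /=; apply: eq_bigr => j _.
have := ltn_ord i; have := ltn_ord j; rewrite !ltnS => jn im.
rewrite -scalerAl -scalerAr scalerA -exprD !revpZ !revpXn ?leq_add //.
rewrite -scalerAl -scalerAr scalerA -exprD rmorphM.
by congr (_ *: 'X^_); lia.
Qed.

Lemma revp1 : revp 0 1 = 1.
Proof. by apply/polyP=> -[|i]; rewrite coef_revp !coefC //= rmorph1. Qed.

Lemma revpXsubC c : revp 1 ('X - c%:P) = 1 - c^* *: 'X.
Proof.
apply/polyP=> -[|[|i]]; rewrite coef_revp !coefB !coefX !coefC ?coefZ ?coef1 ?coefX //=.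
- by rewrite subr0 rmorph1 mulr0 subr0.
- by rewrite sub0r rmorphN mulr1 sub0r.
- by rewrite mulr0 subrr.
Qed.

Lemma revpS n p : (size p <= n.+1)%N -> revp n.+1 p = 'X * revp n p.
Proof.
move=> sp; rewrite -[p in LHS]mul1r -[n.+1]add1n revpM ?size_poly1 //.
by rewrite -[X in revp 1 X](expr0 'X) revpXn // expr1.
Qed.

Lemma revp_mulX n p : (size p <= n.+1)%N -> revp n.+1 ('X * p) = revp n p.
Proof.
move=> sp; rewrite -[n.+1]add1n revpM ?size_polyX //.
by rewrite -[X in revp 1 X]expr1 revpXn // mul1r.
Qed.

(** Coefficients beyond [n] are ignored, which makes this a squared norm on polynomials modulo
    [X^(n+1)]. *)
Definition sqn n p := \sum_(i < n.+1) `|p`_i| ^+ 2.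

(** For [p] of degree at most [n], the product is [z^n |p|^2] on the unit circle, so its middle
    coefficient is the mean of [|p|^2]. *)
Lemma sqnE n p : sqn n p = (p * revp n p)`_n.
Proof.
rewrite coefM; apply: eq_bigr => i _.
by rewrite coef_revp leq_subr subKn ?normCK // -ltnS.
Qed.

Lemma sqn_eqmodX n p q : eqmodX n.+1 p q -> sqn n p = sqn n q.
Proof. by move=> pq; apply: eq_bigr => i _; rewrite (eqmodX_coef pq). Qed.

Lemma sqnZ n c p : sqn n (c *: p) = `|c| ^+ 2 * sqn n p.
Proof. by rewrite mulr_sumr; apply: eq_bigr => i _; rewrite coefZ normrM exprMn. Qed.

(** A polynomial and its reversal have the same modulus on the circle; algebraically, both norms are
    read off the product [p p# r r#]. *)
Lemma sqn_mul_revp k m p r : (size p <= k.+1)%N -> (size r <= m.+1)%N ->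
  sqn (k + m) (p * revp m r) = sqn (k + m) (p * r).
Proof.
move=> sp sr; rewrite !sqnE !revpM ?size_revp // revpK //.
by rewrite mulrACA [revp m r * r]mulrC mulrACA.
Qed.

(** The two factors have equal modulus on the circle, so without truncation the norms would agree.
    For [p] cut at degree [n], truncation discards the coefficients [- c^* p_n] and [p_n] of degree
    [n+1], whence the defect. *)
Lemma sqn_blaschke_factor n c p :
  sqn n ((1 - c^* *: 'X) * p) - sqn n (('X - c%:P) * p)
    = (1 - `|c| ^+ 2) * `|p`_n| ^+ 2.
Proof.
have sqnS m q : sqn m.+1 q = sqn m q + `|q`_m.+1| ^+ 2 by rewrite /sqn big_ord_recr.
elim: n => [|n IH].
  rewrite /sqn !big_ord1 !mulrBl mul1r -scalerAl !coefB coefZ coefXM coefCM /=.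
  by rewrite mulr0 subr0 sub0r normrN normrM exprMn; ring.
rewrite !sqnS opprD addrACA IH.
rewrite [(1 - _) * p]mulrBl [('X - _) * p]mulrBl mul1r -scalerAl !coefB coefZ !coefXM coefCM /=.
rewrite !normCK !rmorphB !rmorphM /= !conjCK; ring.
Qed.

End Reversal.

(** * Blaschke factors *)

Section Zeros.
Variable C : numClosedFieldType.
Implicit Types (p q r u g : {poly C}) (n m k : nat) (a c : C) (s : seq C).

(** The difference of the squares is [(|a|^2 - 1) (1 - |z|^2)]. *)
Lemma ler_one_sub_conj a z : 1 <= `|a| -> `|z| < 1 -> `|1 - z * a^*| <= `|z - a|.
Proof.
move=> a1 z1; rewrite -(ler_pXn2r (n := 2)) ?nnegrE //.
have : 0 <= (`|a| ^+ 2 - 1) * (1 - `|z| ^+ 2).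
  by rewrite mulr_ge0 // subr_ge0 ?exprn_ege1 // expr_le1 // ltW.
rewrite -subr_ge0; congr (_ <= _).
by rewrite !normCK !rmorphB !rmorphM /= !conjCK rmorph1; ring.
Qed.

Lemma sub_conj_neq0 a z : `|a| < 1 -> `|z| < 1 -> 1 - z * a^* != 0.
Proof.
move=> a1 z1; rewrite subr_eq0; apply/eqP => /(congr1 Num.norm)/eqP.
rewrite normr1 normrM norm_conjC eq_sym lt_eqF //.
by rewrite -[1]mulr1 ltr_pM.
Qed.

(** The Blaschke product with zeros [s] is [inner_num s / inner_den s]. Keeping the two polynomials
    apart lets it act modulo [X^(n+1)] without division. *)
Definition inner_num s : {poly C} := \prod_(a <- s) ('X - a%:P).
Definition inner_den s : {poly C} := \prod_(a <- s) (1 - a^* *: 'X).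

Lemma size_inner_num s : size (inner_num s) = (size s).+1.
Proof. by rewrite /inner_num size_prod_XsubC. Qed.

Lemma inner_num_neq0 s : inner_num s != 0.
Proof. by rewrite -size_poly_gt0 size_inner_num. Qed.

Lemma revp_inner_num s : revp (size s) (inner_num s) = inner_den s.
Proof.
rewrite /inner_num /inner_den; elim: s => [|a s IH]; first by rewrite !big_nil revp1.
rewrite !big_cons /= -add1n revpM ?size_XsubC //; last by rewrite size_prod_XsubC.
by rewrite revpXsubC IH.
Qed.

Lemma inner_den_neq0 s z : all (fun a => `|a| < 1) s -> `|z| < 1 ->
  (inner_den s).[z] != 0.
Proof.
move=> /allP s1 z1; rewrite horner_prod big_seq.
elim/big_rec: _ => [|a x /s1 a1 xN0]; first by rewrite oner_neq0.
by rewrite mulf_neq0 // !hornerE mulrC sub_conj_neq0.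
Qed.

Lemma inner_factorization q : q != 0 ->
  exists s r, [/\ q = inner_num s * r, all (fun a => `|a| < 1) s
    & forall z : C, `|z| < 1 -> r.[z] != 0].
Proof.
move=> q0; have [s Es] := closed_field_poly_normal q.
exists [seq a <- s | `|a| < 1].
exists (lead_coef q *: \prod_(a <- s | ~~ (`|a| < 1)) ('X - a%:P)); split.
- rewrite {1}Es -scalerAr /inner_num big_filter.
  by rewrite (bigID (fun a => `|a| < 1)).
- exact: filter_all.
- move=> z z1; rewrite hornerZ mulf_neq0 ?lead_coef_eq0 // horner_prod.
  elim/big_rec: _ => [|a x a1 xN0]; first by rewrite oner_neq0.
  rewrite mulf_neq0 // !hornerE subr_eq0; apply: contra a1 => /eqP <- //.
Qed.

(* On the unit circle the hypothesis reads [|u|^2 = c |g|^2]: the bound inside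
   the disk is the maximum principle for [u / g], obtained here by dividing out
   the roots of [g] (roots at infinity included) one at a time. *)
Lemma norm_le_of_revp_eq n u g c : 0 <= c ->
  (size u <= n.+1)%N -> (size g <= n.+1)%N ->
  u * revp n u = c *: (g * revp n g) ->
  (forall z : C, `|z| < 1 -> g.[z] != 0) ->
  forall z : C, `|z| < 1 -> `|u.[z]| ^+ 2 <= c * `|g.[z]| ^+ 2.
Proof.
move=> c0; elim: n u g => [|n IH] u g su sg ug g1 z z1.
  move: (congr1 (fun p : {poly C} => p`_0) ug).
  rewrite coefZ -!sqnE /sqn !big_ord1 => E.
  by rewrite (size1_polyC su) (size1_polyC sg) !hornerC E.
have drop_infinity p q : (size p <= n.+1)%N -> (size q <= n.+1)%N ->
    p * revp n.+1 p = c *: (q * revp n.+1 q) -> p * revp n p = c *: (q * revp n q).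
  move=> sp sq; rewrite !revpS // !(mulrCA _ 'X) scalerAr => /mulfI; apply.
  by rewrite polyX_eq0.
(* Here [g] has a root at infinity relative to the formal degree [n+1]. The constant coefficient of
   [u u#] is [u_0 conj(u_(n+1))], so [u] vanishes at 0 or at infinity and the formal degree can be
   lowered. *)
have [sg'|sg'] := ltnP (size g) n.+2.
  have [[v Ev]|su'] : (exists v, u = 'X * v) \/ (size u <= n.+1)%N.
  - have : (u * revp n.+1 u)`_0 = 0.
      by rewrite ug revpS // mulrCA coefZ coefXM mulr0.
    rewrite coefM big_ord1 coef_revp /= subn0 => /eqP; rewrite mulf_eq0 => /orP[u0|].
      left; exists (drop_poly 1 u); rewrite -[LHS](poly_take_drop 1) mulrC.
      rewrite [take_poly 1 u](_ : _ = 0) ?add0r //.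
      by apply/polyP=> -[|i]; rewrite coef_take_poly coef0 //; apply/eqP.
    rewrite conjC_eq0 => un; right; move: su; rewrite leq_eqVlt => /orP[/eqP su|//].
    have : lead_coef u == 0 by rewrite lead_coefE su.
    by rewrite lead_coef_eq0 => /eqP ->; rewrite size_poly0.
  - have sv : (size v <= n.+1)%N.
      have [->|v0] := eqVneq v 0; first by rewrite size_poly0.
      by move: su; rewrite Ev mulrC size_mulX.
    rewrite Ev hornerM hornerX normrM exprMn.
    apply: (@le_trans _ _ (`|v.[z]| ^+ 2)).
      by rewrite ler_piMl ?exprn_ge0 // expr_le1 // ltW.
    apply: IH => //; apply: (@mulfI _ 'X); first by rewrite polyX_eq0.
    rewrite mulrA; move: ug; rewrite Ev revp_mulX // [revp n.+1 g]revpS // => ->.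
    by rewrite -scalerAr (mulrCA g).
  - by apply: IH => //; apply: drop_infinity.
have /closed_rootP[a] : size g != 1%N by apply/eqP; lia.
rewrite -dvdp_XsubCl => /dvdpP[h Eg].
have a1 : 1 <= `|a|.
  rewrite real_leNgt ?normr_real ?real1 //; apply/negP => /g1.
  by rewrite Eg !hornerE subrr mulr0 eqxx.
have a0 : a != 0 by rewrite -normr_gt0 (lt_le_trans _ a1).
have h1 (x : C) : `|x| < 1 -> h.[x] != 0.
  by move=> /g1; rewrite Eg hornerM mulf_eq0 negb_or => /andP[].
have size_div p q : (size p <= n.+2)%N -> p = ('X - a%:P) * q -> (size q <= n.+1)%N.
  move=> sp Ep; have [->|q0] := eqVneq q 0; first by rewrite size_poly0.
  by move: sp; rewrite Ep mulrC size_Mmonic ?monicXsubC // size_XsubC addn2.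
have sh : (size h <= n.+1)%N by apply: size_div sg _; rewrite Eg mulrC.
pose f : {poly C} := 1 - a^* *: 'X.
have revpM1 p : (size p <= n.+1)%N -> revp n.+1 (('X - a%:P) * p) = f * revp n p.
  by move=> sp; rewrite -[n.+1]add1n revpM ?size_XsubC // revpXsubC.
have nz : ('X - a%:P) * f != 0.
  rewrite mulf_neq0 ?polyXsubC_eq0 //; apply/eqP=> /(congr1 (horner^~ 0)).
  by rewrite /f !hornerE ?mulr0 ?subr0 => /eqP; rewrite oner_eq0.
have Egg : g * revp n.+1 g = (('X - a%:P) * f) * (h * revp n h).
  by rewrite Eg mulrC [h * _]mulrC revpM1 //; ring.
have {}IH (v : {poly C}) : (size v <= n.+1)%N ->
    u * revp n.+1 u = (('X - a%:P) * f) * (v * revp n v) ->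
    `|v.[z]| ^+ 2 <= c * `|h.[z]| ^+ 2.
  move=> sv Ev; apply: IH => //; apply: (mulfI nz).
  by rewrite -Ev ug Egg scalerAr.
(* A finite root [a] of [g] lies outside the open disk. It is a root of [u] or of [u#]; in the
   second case [u] contains the factor [1 - a^* z], which is dominated by [z - a] in the disk. *)
have : root u a || root (revp n.+1 u) a.
  by rewrite -rootM ug Egg /root hornerZ !hornerM hornerXsubC subrr !mul0r mulr0.
have conclude (v : {poly C}) x : u.[z] = x * v.[z] -> `|x| <= `|z - a| ->
    `|v.[z]| ^+ 2 <= c * `|h.[z]| ^+ 2 -> `|u.[z]| ^+ 2 <= c * `|g.[z]| ^+ 2.
  move=> -> xa v1; rewrite Eg hornerM hornerXsubC !normrM !exprMn.
  rewrite [X in _ <= X]mulrA [X in _ <= X]mulrC.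
  by apply: ler_pM; rewrite ?exprn_ge0 ?ler_pXn2r ?nnegrE.
case/orP; rewrite -dvdp_XsubCl => /dvdpP[v]; rewrite mulrC => Ev.
  have sv := size_div _ _ su Ev.
  apply: (conclude v (z - a)) => //; first by rewrite Ev hornerM hornerXsubC.
  by apply: IH => //; rewrite Ev revpM1 //; ring.
have sv := size_div _ _ (size_revp _ _) Ev.
have Eu : u = f * revp n v by rewrite -[u](revpK su) Ev revpM1.
apply: (conclude (revp n v) (1 - z * a^*)).
- rewrite {1}Eu hornerM; congr (_ * _).
  by rewrite /f hornerD hornerN hornerZ hornerX hornerC mulrC.
- exact: ler_one_sub_conj.
- by apply: IH; rewrite ?size_revp // Ev {1}Eu revpK //; ring.
Qed.

End Zeros.

Section Blaschke.
Variable C : numClosedFieldType.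
Implicit Types (p q r u v y : {poly C}) (n m k : nat) (a c : C) (s : seq C).

(** The factors are applied one at a time. With [t] the quotient of [y] by [1 - a^* X] modulo
    [X^(n+1)], passing from [y] to [(X - a) t] loses [(1 - |a|^2) |t_n|^2]. *)
Lemma blaschke_contraction n s y v : all (fun a => `|a| < 1) s ->
  eqmodX n.+1 (inner_num s * y) (inner_den s * v) -> sqn n v <= sqn n y.
Proof.
rewrite /inner_num /inner_den; elim: s y => [|a s IH] y.
  by rewrite !big_nil !mul1r => _ /sqn_eqmodX ->.
rewrite !big_cons => /= /andP[a1 s1] E.
pose t := (\sum_(i < n.+1) (a^* *: 'X) ^+ i) * y.
have Et : eqmodX n.+1 ((1 - a^* *: 'X) * t) y.
  by rewrite mulrA -[X in eqmodX _ _ X]mul1r; apply/eqmodXMr/geometric_inverse.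
apply: (@le_trans _ _ (sqn n (('X - a%:P) * t))).
  apply: (IH _ s1); apply: (@eqmodX_geometricK _ _ (a^*)).
  rewrite [X in eqmodX _ _ X]mulrA; apply: eqmodX_trans E.
  rewrite [X in eqmodX _ X](_ : _ = ('X - a%:P) * \prod_(j <- s) ('X - j%:P) * ((1 - a^* *: 'X) * t)).
    exact: eqmodXMl.
  by ring.
rewrite -(sqn_eqmodX Et) -subr_ge0 sqn_blaschke_factor.
by rewrite mulr_ge0 ?exprn_ge0 // subr_ge0 expr_le1 // ltW.
Qed.

(* By [sqn_blaschke_factor], a factor preserves the norm of [(1 - a^* X) t] as
   soon as the coefficient [t_n] vanishes: one linear condition per factor. *)
Lemma blaschke_isometry n s :
  exists M : 'M[C]_(n.+1, size s), forall x : 'rV_n.+1,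
    exists2 v, eqmodX n.+1 (inner_num s * rVpoly x) (inner_den s * v)
      & x *m M = 0 -> sqn n v = sqn n (rVpoly x).
Proof.
rewrite /inner_num /inner_den; elim: s => [|a s [M HM]].
  exists 0 => x; exists (rVpoly x) => //.
  by rewrite !big_nil; apply: eqmodX_refl.
pose h := \sum_(i < n.+1) (a^* *: 'X) ^+ i.
(* [H] divides by [1 - a^* X], [S] multiplies by [X - a], and [M1] extracts the top coefficient
   [t_n] of the quotient. *)
pose H := toeplitz_upper n h; pose S := toeplitz_upper n ('X - a%:P).
pose M1 := H *m delta_mx ord_max (0 : 'I_1).
exists (row_mx M1 (H *m S *m M)) => x.
have Et : eqmodX n.+1 ((1 - a^* *: 'X) * rVpoly (x *m H)) (rVpoly x).
  apply: eqmodX_trans (eqmodXMl _ (rVpoly_toeplitz h x)) _.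
  by rewrite mulrA -[X in eqmodX _ _ X]mul1r; apply/eqmodXMr/geometric_inverse.
have ES : eqmodX n.+1 (rVpoly (x *m H *m S)) (('X - a%:P) * rVpoly (x *m H)).
  exact: rVpoly_toeplitz.
have [v Ev vM] := HM (x *m H *m S); exists v.
  rewrite !big_cons -[X in eqmodX _ _ X]mulrA.
  apply: eqmodX_trans (eqmodXMl _ (eqmodX_sym Et)) _.
  apply: eqmodX_trans _ (eqmodXMl _ Ev).
  apply: eqmodX_trans _ (eqmodXMl _ (eqmodXMl _ (eqmodX_sym ES))).
  rewrite [X in eqmodX _ X](_ : _ = (1 - a^* *: 'X) * (\prod_(j <- s) ('X - j%:P) *
    (('X - a%:P) * rVpoly (x *m H)))); last by ring.
  exact: eqmodX_refl.
move=> xM0; have : x *m row_mx M1 (H *m S *m M) = 0 by [].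
rewrite mul_mx_row -[X in _ = X]row_mx0 => /eq_row_mx[x1 xM].
rewrite vM; last by move: xM; rewrite !mulmxA.
rewrite (sqn_eqmodX ES).
rewrite -(sqn_eqmodX Et); apply/eqP; rewrite eq_sym -subr_eq0 sqn_blaschke_factor.
suff -> : (rVpoly (x *m H))`_n = 0 by rewrite normr0 expr0n mulr0.
have := coef_rVpoly_ord (x *m H) ord_max => /= ->.
by move: x1; rewrite mulmxA -colE => /matrixP/(_ 0 0); rewrite !mxE.
Qed.

End Blaschke.

(** * Singular values *)

Section Inertia.
Variable C : numClosedFieldType.

Lemma num_neg_eigenvaluesE m (A : 'M[C]_m) (d : 'I_m -> C) :
  char_poly A = \prod_i ('X - (d i)%:P) ->
  num_neg_eigenvalues A = #|[pred i | d i < 0]|.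
Proof.
move=> E; rewrite /num_neg_eigenvalues /eigenvalues.
case: closed_field_poly_normal => s /=; rewrite (monicP (char_poly_monic A)) scale1r.
rewrite E -big_enum -(big_map d xpredT (fun a => 'X - a%:P)) => /prod_XsubC_eq.
rewrite perm_sym => /permP ->; rewrite count_map enumT cardE size_filter.
exact: eq_count.
Qed.

Lemma char_poly_similar m (P A B : 'M[C]_m) : P \in unitmx -> P *m A = B *m P ->
  char_poly A = char_poly B.
Proof.
move=> uP E; have uP' : \det (map_mx polyC P) != 0.
  by rewrite det_map_mx polyC_eq0 -unitfE -unitmxE.
apply: (mulfI uP'); rewrite [RHS]mulrC -!det_mulmx; congr (\det _).
rewrite /char_poly_mx mulmxBr mulmxBl -!map_mxM E; congr (_ - _).
by rewrite scalar_mxC.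
Qed.

Definition sqrow m (x : 'rV[C]_m) : C := \sum_i `|x 0 i| ^+ 2.

Lemma sqrowE m (x : 'rV[C]_m) : (x *m x^t*) 0 0 = sqrow x.
Proof. by rewrite mxE; apply: eq_bigr => i _; rewrite !mxE normCK. Qed.

(** Spectral theorem for the Hermitian matrix [T T^*]: the rows of [P] are orthonormal left
    eigenvectors and [d] lists the squared singular values, those above 1 being the negative
    eigenvalues of [1 - T T^*]. *)
Lemma gram_spectral m (T : 'M[C]_m) : exists (P : 'M[C]_m) (d : 'rV[C]_m),
  [/\ P \is unitarymx, T *m T^t* = P^t* *m diag_mx d *m P, forall i, 0 <= d 0 i
    & num_neg_eigenvalues (1%:M - T *m T^t*) = #|[pred i | 1 < d 0 i]|].
Proof.
pose A := T *m T^t*.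
have Aherm : A \is hermsymmx.
  apply/is_hermitianmxP; rewrite expr0 scale1r /A trmx_mul map_mxM.
  by rewrite trmxCK.
have uP := spectral_unitarymx A.
have AE := orthomx_spectralP (hermitian_normalmx Aherm).
rewrite invmx_unitary // in AE.
set P := spectralmx A in uP AE; set d := spectral_diag A in AE.
have PA : P *m A = diag_mx d *m P.
  by rewrite AE !mulmxA (unitarymxP uP) mul1mx.
exists P, d; split => //.
  move=> i; have : (P *m A *m P^t*) i i = d 0 i.
    by rewrite PA -mulmxA (unitarymxP uP) mulmx1 mxE eqxx mulr1n.
  have -> : P *m A *m P^t* = (P *m T) *m (P *m T)^t*.
    by rewrite trmx_mul map_mxM !mulmxA.
  rewrite mxE => <-; apply: sumr_ge0 => j _.
  by rewrite !mxE -normCK exprn_ge0.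
rewrite (@num_neg_eigenvaluesE _ _ (fun i => 1 - d 0 i)).
  by apply: eq_card => i; rewrite !inE subr_lt0.
rewrite (char_poly_similar (B := 1%:M - diag_mx d) (unitarymx_unit uP)).
  rewrite char_poly_trig; first by apply: eq_bigr => i _; rewrite !mxE eqxx mulr1n.
  apply/is_trig_mxP => i j ij; rewrite !mxE.
  by rewrite -val_eqE /= (ltn_eqF ij) subr0.
by rewrite mulmxBr mulmxBl mulmx1 mul1mx PA.
Qed.

End Inertia.

Section SingularValues.
Variable C : numClosedFieldType.

Lemma left_kernel_neq0 (F : fieldType) p k (N : 'M[F]_(p, k)) : (k < p)%N ->
  exists2 y : 'rV_p, y != 0 & y *m N = 0.
Proof.
move=> kp; have : kermx N != 0.
  by rewrite kermx_eq0 /row_free neq_ltn (leq_ltn_trans (rank_leq_col N)).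
by case/rowV0Pn => y /sub_kermxP yN y0; exists y.
Qed.

Lemma sqrow_unitary m (P : 'M[C]_m) (x : 'rV_m) : P \is unitarymx ->
  sqrow (x *m P) = sqrow x.
Proof.
move=> uP; rewrite -!sqrowE trmx_mul map_mxM mulmxA -(mulmxA x) (unitarymxP uP).
by rewrite mulmx1.
Qed.

Lemma sqrow_gram m (T P : 'M[C]_m) (d : 'rV_m) (x : 'rV_m) :
  P \is unitarymx -> T *m T^t* = P^t* *m diag_mx d *m P ->
  sqrow (x *m P *m T) = \sum_i d 0 i * `|x 0 i| ^+ 2.
Proof.
move=> uP E; rewrite -sqrowE trmx_mul map_mxM mulmxA -[_ *m T *m _]mulmxA E.
rewrite trmx_mul map_mxM !mulmxA -(mulmxA x) (unitarymxP uP) mulmx1.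
rewrite -[_ *m P *m _]mulmxA (unitarymxP uP) mulmx1 mul_mx_diag mxE.
by apply: eq_bigr => i _; rewrite !mxE normCK mulrAC mulrC.
Qed.

(** Otherwise the eigenvectors with eigenvalue above 1 would span more than [k] dimensions and
    contain a nonzero [x] killed by [M]. Such an [x] is strictly expanded by [T]. *)
Lemma num_neg_le m k (T : 'M[C]_m) (M : 'M[C]_(m, k)) :
  (forall x : 'rV_m, x *m M = 0 -> sqrow (x *m T) <= sqrow x) ->
  (num_neg_eigenvalues (1%:M - T *m T^t*) <= k)%N.
Proof.
move=> HM; have [P [d [uP TE d0 ->]]] := gram_spectral T.
set I := [pred i | 1 < d 0 i]; rewrite leqNgt; apply/negP => kI.
pose E : 'M[C]_(#|I|, m) := rowsub (@enum_val _ I) 1%:M.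
have [y y0 yN] := left_kernel_neq0 (E *m P *m M) kI.
pose z := y *m E.
have zE i : z 0 (enum_val i) = y 0 i.
  rewrite mxE (bigD1 i) //= !mxE eqxx mulr1 big1 ?addr0 // => j ji.
  by rewrite !mxE (inj_eq enum_val_inj) (negPf ji) mulr0.
have zI i : i \notin I -> z 0 i = 0.
  move=> iI; rewrite mxE big1 // => j _; rewrite !mxE.
  case: eqP => [ji|_]; last by rewrite mulr0.
  by move: iI; rewrite -ji enum_valP.
have zM : z *m P *m M = 0 by rewrite -yN /z !mulmxA.
move: (HM _ zM); rewrite (sqrow_gram _ uP TE) sqrow_unitary // -subr_ge0 /sqrow -sumrB.
have le0 i : `|z 0 i| ^+ 2 - d 0 i * `|z 0 i| ^+ 2 <= 0.
  have [iI|/zI ->] := boolP (i \in I); last by rewrite normr0 expr0n mulr0 subr0.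
  by rewrite -{1}[_ ^+ 2]mul1r -mulrBl mulr_le0_ge0 ?exprn_ge0 // subr_le0 ltW.
move=> ge0; have /eqP : \sum_i (d 0 i * `|z 0 i| ^+ 2 - `|z 0 i| ^+ 2) = 0.
  apply/le_anti; rewrite -oppr_ge0 -sumrN.
  under eq_bigr do rewrite opprB.
  by rewrite ge0 sumr_ge0 // => i _; rewrite -oppr_le0 opprB.
rewrite psumr_eq0 => [/allP z0|i _]; last by rewrite -oppr_le0 opprB.
case/negP: y0; apply/eqP/rowP => i; rewrite mxE -zE.
have := z0 (enum_val i) (mem_index_enum _).
rewrite -{2}[_ ^+ 2]mul1r -mulrBl mulf_eq0 subr_eq0 expf_eq0 normr_eq0.
by have := enum_valP i; rewrite inE => /gt_eqF -> /= /eqP.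
Qed.

(** [c] is the largest eigenvalue of [T T^*] not exceeding 1, and [M] tests orthogonality to the
    eigenvectors above 1. On their orthogonal complement [c] is the maximum of the Rayleigh
    quotient, attained only at eigenvectors for [c]. *)
Lemma next_singular_value m (T : 'M[C]_m) :
  let k := num_neg_eigenvalues (1%:M - T *m T^t*) in (k < m)%N ->
  exists (c : C) (x0 : 'rV_m) (M : 'M[C]_(m, k)),
  [/\ 0 <= c <= 1, x0 != 0, x0 *m (T *m T^t*) = c *: x0
    & forall x : 'rV_m, x *m M = 0 -> (c * sqrow x <= sqrow (x *m T)) ->
      x *m (T *m T^t*) = c *: x].
Proof.
have [P [d [uP TE d0 ->]]] := gram_spectral T => /=.
set I := [pred i | 1 < d 0 i] => kI.
have [i0 i0I] : exists i, i \notin I.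
  apply/existsP; rewrite -negb_forall; apply: contraL kI => /forallP iI.
  by rewrite -leqNgt (eq_card (B := predT)) ?card_ord // => i; rewrite iI.
have dr i : d 0 i \is Num.real by rewrite ger0_real.
have [i1 i1I i1max] := @real_arg_maxP _ _ i0 [predC I] (fun i => d 0 i) i0I
  (fun i _ => dr i).
pose c := d 0 i1; exists c, (row i1 P), ((rowsub (@enum_val _ I) P)^t*).
have PP : P^t* *m P = 1%:M by apply: mulmx1C; apply/unitarymxP.
have eigP x : x *m P *m (T *m T^t*) = x *m diag_mx d *m P.
  by rewrite TE !mulmxA -(mulmxA x) (unitarymxP uP) mulmx1.
split.
- by rewrite d0 /c real_leNgt ?real1.
- apply/eqP => P0; have := unitarymx_unit uP; rewrite -row_free_unit => /row_free_inj.
  move=> /(_ 1 (delta_mx 0 i1) 0); rewrite mul0mx -rowE P0 => /(_ erefl).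
  by move/rowP/(_ i1); rewrite !mxE !eqxx => /eqP; rewrite oner_eq0.
- rewrite rowE eigP scalemxAl; congr (_ *m _); apply/rowP=> i.
  rewrite mul_mx_diag !mxE eqxx /= mulrC.
  by case: eqP => [->|]; rewrite ?mulr0 // mulr1.
move=> x; pose z := x *m (P^t*).
have -> : x = z *m P by rewrite /z -mulmxA PP mulmx1.
move: z => z zM; rewrite sqrow_unitary // (sqrow_gram _ uP TE) => ineq.
have zI i : i \in I -> z 0 i = 0.
  move=> iI; move/rowP/(_ (enum_rank_in iI i)): zM.
  rewrite (_ : _ *m _ = colsub (@enum_val _ I) z); last first.
    have zE : z = z *m P *m P^t* by rewrite -mulmxA (unitarymxP uP) mulmx1.
    rewrite [in RHS]zE; apply/rowP=> j; rewrite [RHS]mxE ![LHS]mxE [RHS]mxE.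
    by apply: eq_bigr => l _; rewrite !mxE.
  by rewrite !mxE enum_rankK_in.
have ge0 i : 0 <= c * `|z 0 i| ^+ 2 - d 0 i * `|z 0 i| ^+ 2.
  have [/zI ->|iI] := boolP (i \in I); first by rewrite normr0 expr0n !mulr0 subr0.
  by rewrite -mulrBl mulr_ge0 ?exprn_ge0 // subr_ge0; apply: i1max.
have /eqP : \sum_i (c * `|z 0 i| ^+ 2 - d 0 i * `|z 0 i| ^+ 2) = 0.
  apply/le_anti; rewrite sumr_ge0 // andbT sumrB -mulr_sumr subr_le0 //.
rewrite psumr_eq0 // => /allP z0; rewrite eigP scalemxAl; congr (_ *m _).
apply/rowP=> i; rewrite mul_mx_diag !mxE; have := z0 i (mem_index_enum _).
rewrite -mulrBl mulf_eq0 subr_eq0 expf_eq0 normr_eq0 /= => /orP[/eqP ->|/eqP ->].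
  by rewrite mulrC.
by rewrite !(mul0r, mulr0).
Qed.

Lemma num_neg_toeplitz n (w : {poly C}) (T := toeplitz_upper n w) :
  num_neg_eigenvalues (1%:M - T ^t* *m T) = num_neg_eigenvalues (1%:M - T *m T^t*).
Proof.
(* Conjugation by the flip [J] exchanges [T] and its transpose. *)
pose J : 'M[C]_n.+1 := \matrix_(i, j) (j == rev_ord i)%:R.
have JM (A : 'M[C]_n.+1) i j : (J *m A) i j = A (rev_ord i) j.
  rewrite mxE (bigD1 (rev_ord i)) //= mxE eqxx mul1r big1 ?addr0 // => k ki.
  by rewrite mxE (negPf ki) mul0r.
have MJ (A : 'M[C]_n.+1) i j : (A *m J) i j = A i (rev_ord j).
  rewrite mxE (bigD1 (rev_ord j)) //= mxE rev_ordK eqxx mulr1 big1 ?addr0 // => k ki.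
  by rewrite mxE -(inj_eq rev_ord_inj) rev_ordK eq_sym (negPf ki) mulr0.
have uJ : J \in unitmx.
  have JJ : J *m J = 1%:M.
    apply/matrixP=> i j; rewrite JM !mxE; congr (nat_of_bool _)%:R.
    by rewrite rev_ordK eq_sym.
  by case/mulmx1_unit: JJ.
have JT : J *m T^T = T *m J.
  apply/matrixP=> i j; rewrite JM MJ !mxE /=.
  by have := ltn_ord i; have := ltn_ord j; rewrite !subSS => jn im;
    rewrite (_ : (j <= n - i)%N = (i <= n - j)%N); [congr (if _ then _`__ else _)|]; lia.
have JTc : J *m (T^t*)^T = T^t* *m J.
  apply/matrixP=> i j; rewrite JM MJ !mxE /=; congr (_^*).
  have := ltn_ord i; have := ltn_ord j; rewrite !subSS => jn im.
  by rewrite (_ : (n - i <= j)%N = (n - j <= i)%N); [congr (if _ then _`__ else _)|]; lia.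
rewrite {1}/num_neg_eigenvalues /eigenvalues.
suff -> : char_poly (1%:M - T^t* *m T) = char_poly (1%:M - T *m T^t*) by [].
(* Transposition preserves the characteristic polynomial, and [J] conjugates the transpose of
   [1 - T^* T] into [1 - T T^*]. *)
rewrite -[LHS]det_tr (_ : _^T = char_poly_mx (1%:M - T^t* *m T)^T).
  apply: (char_poly_similar uJ).
  rewrite linearB /= tr_scalar_mx trmx_mul mulmxBr mulmxBl mulmx1 mul1mx.
  by rewrite mulmxA JT -mulmxA JTc mulmxA.
by rewrite /char_poly_mx linearB /= tr_scalar_mx map_trmx.
Qed.

End SingularValues.

(** * Schmidt pairs *)

Section TakagiPair.
Variable C : numClosedFieldType.
Implicit Types (p q r u v y : {poly C}) (n m k : nat) (a c : C) (s : seq C).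

Lemma sqrow_rVpoly n (x : 'rV[C]_n.+1) : sqrow x = sqn n (rVpoly x).
Proof. by apply: eq_bigr => i _; rewrite coef_rVpoly_ord. Qed.

Lemma dot_rVpoly n (x y : 'rV[C]_n.+1) :
  (x *m y^t*) 0 0 = (rVpoly x * revp n (rVpoly y))`_n.
Proof.
rewrite mxE coefM; apply: eq_bigr => i _.
by rewrite !mxE coef_rVpoly_ord coef_revp leq_subr subKn ?leq_ord // coef_rVpoly_ord.
Qed.

(** For [u = x T], coefficient [i] of [w u#] is the inner product of [X^(n-i) T] with [x T], that
    is, of [X^(n-i)] with [x T T^* = c x]. *)
Lemma eigenvector_toeplitz n (w : {poly C}) c (T := toeplitz_upper n w)
    (x : 'rV_n.+1) : c \is Num.real -> x *m (T *m T^t*) = c *: x ->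
  eqmodX n.+1 (w * revp n (rVpoly (x *m T))) (c *: revp n (rVpoly x)).
Proof.
move=> cr xE; apply: coef_eqmodX => i; rewrite ltnS => ni.
pose z : 'rV[C]_n.+1 := poly_rV 'X^(n - i).
have zE : rVpoly z = 'X^(n - i) by rewrite poly_rV_K // size_polyXn; lia.
have : (z *m T *m (x *m T)^t*) 0 0 = c * (z *m x^t*) 0 0.
  have -> : z *m T *m (x *m T)^t* = z *m (x *m (T *m T^t*))^t*.
    by rewrite !trmx_mul !map_mxM !trmxCK !mulmxA.
  rewrite xE linearZ /= map_mxZ -scalemxAr mxE; congr (_ * _).
  exact/CrealP.
rewrite !dot_rVpoly.
have Ez : eqmodX n.+1 (rVpoly (z *m T) * revp n (rVpoly (x *m T)))
    ('X^(n - i) * (w * revp n (rVpoly (x *m T)))).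
  rewrite mulrCA mulrA; apply: eqmodXMr; rewrite -zE; exact: rVpoly_toeplitz.
rewrite (eqmodX_coef Ez (ltnSn n)) zE coefZ !coefXnM.
by rewrite ltnNge leq_subr /= subKn.
Qed.

(** Invariance under reversal at degree [2n] recovers the upper coefficients from those of degree at
    most [n]. *)
Lemma revp_fixed_eq n p q : (size p <= (n + n).+1)%N -> (size q <= (n + n).+1)%N ->
  revp (n + n) p = p -> revp (n + n) q = q -> eqmodX n.+1 p q -> p = q.
Proof.
move=> sp sq fp fq pq; apply/polyP=> i.
have [ni|ni] := leqP i n; first by rewrite (eqmodX_coef pq).
have [i2|i2] := leqP i (n + n); last by rewrite !nth_default ?(leq_trans _ i2).
by rewrite -fp -fq !coef_revp i2 (eqmodX_coef pq) //; lia.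
Qed.

Lemma mul_revp_fixed n p : (size p <= n.+1)%N ->
  revp (n + n) (p * revp n p) = p * revp n p.
Proof. by move=> sp; rewrite revpM ?size_revp // revpK // mulrC. Qed.

Lemma size_mul_revp n p : (size p <= n.+1)%N -> (size (p * revp n p)%R <= (n + n).+1)%N.
Proof.
move=> sp; rewrite (leq_trans (size_polyMleq p _)) //.
by have := size_revp n p; lia.
Qed.

(** Modulo [X^(n+1)], [u u# = w x u# = c x x#]; both ends are fixed by reversal at degree [2n], so
    the congruence is an equality. *)
Lemma schmidt_pair_modulus n (w : {poly C}) c (x u : {poly C}) : c \is Num.real ->
  (size x <= n.+1)%N -> (size u <= n.+1)%N -> eqmodX n.+1 (w * x) u ->
  eqmodX n.+1 (w * revp n u) (c *: revp n x) ->
  u * revp n u = c *: (x * revp n x).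
Proof.
move=> cr sx su wx wu; apply: (@revp_fixed_eq n).
- exact: size_mul_revp.
- exact: leq_trans (size_scale_leq _ _) (size_mul_revp sx).
- exact: mul_revp_fixed.
- by rewrite revpZ mul_revp_fixed // (CrealP cr).
- apply: eqmodX_trans (eqmodXMr _ (eqmodX_sym wx)) _.
  by rewrite [w * x]mulrC -mulrA scalerAr; apply: eqmodXMl.
Qed.

(* From a Schmidt pair one builds a vector fixed, up to the factor
   [sqrtC c], by the antilinear involution of the eigenspace. *)
Lemma self_dual_schmidt_vector n (w : {poly C}) c (x u : {poly C}) : 0 <= c -> x != 0 ->
  (size x <= n.+1)%N -> (size u <= n.+1)%N -> eqmodX n.+1 (w * x) u ->
  eqmodX n.+1 (w * revp n u) (c *: revp n x) ->
  exists q, [/\ q != 0, (size q <= n.+1)%N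
    & eqmodX n.+1 (w * q) (sqrtC c *: revp n q)].
Proof.
move=> c0 x0 sx su wx wu; set t := sqrtC c.
have tr : t^* = t by apply/CrealP; rewrite ger0_real // sqrtC_ge0.
have tt : t * t = c by rewrite -expr2 sqrtCK.
(* If the symmetrized vector vanishes, [x] satisfies the relation with the opposite sign.
   Multiplying by ['i], which conjugation negates, corrects it. *)
have [q0|q0] := eqVneq (t *: x + revp n u) 0.
  exists ('i *: x); split.
  - by rewrite scaler_eq0 negb_or neq0Ci.
  - exact: leq_trans (size_scale_leq _ _) sx.
  have -> : t *: revp n ('i *: x) = 'i *: u.
    have /eqP := q0; rewrite addrC addr_eq0 => /eqP ru.
    rewrite -[u in RHS](revpK su) ru -scaleNr !revpZ rmorphN /= tr conjCi.
    by rewrite !scalerA; congr (_ *: _); ring.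
  rewrite -scalerAr -!mul_polyC; exact: eqmodXMl.
exists (t *: x + revp n u); split => //.
  rewrite (leq_trans (size_polyD _ _)) // geq_max size_revp andbT.
  exact: leq_trans (size_scale_leq _ _) sx.
rewrite revpD revpZ tr revpK // scalerDr scalerA tt mulrDr addrC -scalerAr.
by apply: eqmodXD => //; rewrite -!mul_polyC; apply: eqmodXMl.
Qed.

(** The eigenvector is delivered in factored form: [s] lists its zeros in the open disk and [r] is
    the factor without zeros there. *)
Lemma takagi_pair n (w : {poly C}) k (T := toeplitz_upper n w) :
  num_neg_eigenvalues (1%:M - T *m T^t*) = k -> (k < n.+1)%N ->
  exists c s r u,
    [/\ 0 <= c <= 1, (size s <= k)%N /\ all (fun a => `|a| < 1) s,
        r != 0 /\ (size s + size r <= n.+1)%N /\ forall z : C, `|z| < 1 -> r.[z] != 0,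
        (size u <= n.+1)%N /\ eqmodX n.+1 (w * (inner_num s * r)) u
      & u * revp n u = c *: ((inner_num s * r) * revp n (inner_num s * r))].
Proof.
move=> kE kn; have := @next_singular_value _ _ T; rewrite /= kE => /(_ kn).
case=> c [x0 [M [c01 x00 x0E HM]]]; have [c0 c1] := andP c01.
have cr : c \is Num.real by rewrite ger0_real.
have [q [q0 sq wq]] : exists q, [/\ q != 0, (size q <= n.+1)%N
    & eqmodX n.+1 (w * q) (sqrtC c *: revp n q)].
  apply: (self_dual_schmidt_vector (x := rVpoly x0) (u := rVpoly (x0 *m T))) => //.
  - by apply: contra x00 => /eqP x00; rewrite -[x0]rVpolyK x00 linear0.
  - exact: size_poly.
  - exact: size_poly.
  - exact/eqmodX_sym/rVpoly_toeplitz.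
  - exact: eigenvector_toeplitz.
set t := sqrtC c in wq.
have tr : t^* = t by apply/CrealP; rewrite ger0_real // sqrtC_ge0.
have tt : t * t = c by rewrite -expr2 sqrtCK.
have [s0 [r0 [qE s01 r01]]] := inner_factorization q0.
have r00 : r0 != 0 by apply: contraNneq q0; rewrite qE => ->; rewrite mulr0.
have size_q : (size s0 + size r0 <= n.+1)%N.
  by move: sq; rewrite qE size_mul ?inner_num_neq0 // size_inner_num addSn.
have [s0k|ks0] := leqP (size s0) k.
  (* Here [q] itself has few enough zeros, and [w q] is [t q#] modulo [X^(n+1)]. *)
  exists c, s0, r0, (t *: revp n q); rewrite -qE; split => //.
  - split=> //; exact: leq_trans (size_scale_leq _ _) (size_revp _ _).
  - by rewrite revpZ revpK // tr -scalerAl -scalerAr scalerA tt mulrC.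
have [m nE] : exists m, n = (size s0 + m)%N.
  by exists (n - size s0)%N; rewrite subnKC //; move: r00; rewrite -size_poly_gt0; lia.
have sr0 : (size r0 <= m.+1)%N by lia.
(* The [k+1] multiples [X^i r0] face only [k] conditions, so some nonzero combination [P r0] is
   killed by [M]. These multiples fit in degree [n] because [k < size s0]. *)
pose Z : 'M[C]_(k.+1, n.+1) := \matrix_(i < k.+1) poly_rV ('X^i * r0).
have [y y0 yZ] := left_kernel_neq0 (Z *m M) (ltnSn k).
pose x := y *m Z; pose P := rVpoly y.
have P0 : P != 0 by apply: contraNneq y0 => E; rewrite -[y]rVpolyK -/P E linear0.
have sP : (size P <= k.+1)%N by apply: size_poly.
have xE : rVpoly x = P * r0.
  rewrite /x mulmx_sum_row linear_sum [P in RHS](poly_sumX sP) mulr_suml.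
  apply: eq_bigr => i _; rewrite linearZ /= rowK poly_rV_K; last first.
    by rewrite mulrC size_mulXn // (leq_trans _ size_q) // leq_add2r ltnW //; apply: leq_ltn_trans ks0; apply: leq_ord.
  by rewrite coef_rVpoly_ord scalerAl.
have xeig : x *m (T *m T^t*) = c *: x.
  apply: HM; first by rewrite /x -mulmxA.
  rewrite !sqrow_rVpoly xE.
  (* Reversing [r0] keeps the norm. The new polynomial is the image of [w x] under the Blaschke
     product of [s0], so contraction yields the lower bound on [x T]. *)
  have -> : c * sqn n (P * r0) = sqn n (t *: (P * revp m r0)).
    rewrite sqnZ normCK tr tt; congr (_ * _); rewrite nE sqn_mul_revp //.
    by rewrite (leq_trans sP) // ltnS ltnW.
  apply: (blaschke_contraction s01).
  apply: eqmodX_trans (eqmodXMl _ (rVpoly_toeplitz w x)) _.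
  rewrite xE.
  have -> : inner_num s0 * (w * (P * r0)) = P * (w * q) by rewrite qE; ring.
  have -> : inner_den s0 * (t *: (P * revp m r0)) = P * (t *: revp n q).
    rewrite qE nE revpM ?size_inner_num // revp_inner_num -!scalerAr; congr (_ *: _).
    by rewrite mulrCA.
  exact: eqmodXMl.
(* Since [r0] has no zeros in the disk, those of [x = P r0] there come from [P], whose degree is at
   most [k]. *)
have [s [r1 [PE s1 r11]]] := inner_factorization P0.
have r10 : r1 != 0 by apply: contraNneq P0; rewrite PE => ->; rewrite mulr0.
have size_P : (size s + size r1 <= k.+1)%N.
  by move: sP; rewrite PE size_mul ?inner_num_neq0 // size_inner_num addSn.
have r1_gt0 : (0 < size r1)%N by rewrite size_poly_gt0.
exists c, s, (r1 * r0), (rVpoly (x *m T)).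
have -> : inner_num s * (r1 * r0) = rVpoly x by rewrite mulrA -PE xE.
split => //; first (by split=> //; rewrite -ltnS (leq_trans _ size_P) // -addn1 leq_add2l).
- split; first by rewrite mulf_neq0.
  split.
    rewrite size_mul // -(prednK r1_gt0) addSn /= (leq_trans _ size_q) //.
    rewrite addnA leq_add2r -ltnS -addnS prednK // (leq_trans size_P) //.
    by rewrite ltnS ltnW.
  by move=> z z1; rewrite hornerM mulf_neq0 ?r01 ?r11.
- split; [exact: size_poly | exact/eqmodX_sym/rVpoly_toeplitz].
apply: (@schmidt_pair_modulus n w) => //; first exact: size_poly.
- exact: size_poly.
- exact/eqmodX_sym/rVpoly_toeplitz.
- exact: eigenvector_toeplitz.
Qed.

End TakagiPair.

(** * Existence of the pair: rational Schur functions *)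

Section Sufficiency.
Variable R : realType.
Local Notation C := R[i].

Lemma derivable_hornerC (p : {poly C}) (z : C^o) :
  derivable (fun y : C^o => p.[y] : C^o) z 1.
Proof.
elim/poly_ind: p => [|p c IH].
  rewrite (_ : (fun y => _) = cst (0 : C^o)); first exact: derivable_cst.
  by apply/funext => y; rewrite horner0.
rewrite (_ : (fun y => _) = (fun y : C^o => p.[y] : C^o) * id + cst (c : C^o)).
  apply: derivableD; last exact: derivable_cst.
  by apply: derivableM; [exact: IH|exact: derivable_id].
by apply/funext => y; rewrite !fctE !hornerE.
Qed.

Lemma derivable_ratioC (p q : {poly C}) (z : C^o) : q.[z] != 0 ->
  derivable (fun y : C^o => p.[y] / q.[y] : C^o) z 1.
Proof.
move=> qz; apply: derivableM; first exact: derivable_hornerC.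
apply: derivableV => //; exact: derivable_hornerC.
Qed.

Lemma near_ball0 (P : C^o -> Prop) (e : C) : 0 < e ->
  (forall z : C^o, `|z| < e -> P z) -> \forall z \near (0 : C^o), P z.
Proof.
by move=> e0 HP; apply/nbhs_norm0P; exists e.
Qed.

Lemma near_unit_disk : \forall z \near (0 : C^o), `|z| < 1.
Proof. exact: (near_ball0 ltr01). Qed.

Lemma ratio_bounded_near0 (p q : {poly C}) : q.[0] != 0 ->
  exists2 M : C, 0 < M & \forall z \near (0 : C^o), `|p.[z] / q.[z]| <= M.
Proof.
move=> q0; pose r : C^o -> C^o := fun z => p.[z] / q.[z].
have rc : {for 0, continuous r}.
  exact/differentiable_continuous/derivable1_diffP/derivable_ratioC.
exists (`|r 0| + 1); first by rewrite ltr_wpDl.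
have /cvgrPdist_lt/(_ 1 ltr01) := rc; apply: filterS => z rz.
rewrite -/(r z) -[r z](subrK (r 0)) addrC (le_trans (ler_normD _ _)) //.
by rewrite lerD2l distrC ltW.
Qed.

(** The quotient [h / q] is continuous at 0, hence bounded near 0. *)
Lemma bigO_rational n (f g : C^o -> C^o) (h q : {poly C}) :
  (forall z : C, `|z| < 1 -> q.[z] != 0) ->
  (forall z : C, `|z| < 1 -> f z - g z = z ^+ n * (h.[z] / q.[z])) ->
  f = g +O_ (0 : C^o) (fun z => z ^+ n).
Proof.
move=> q0 fg; apply/eqaddOP/bigO_exP.
have [|M M0 HM] := @ratio_bounded_near0 h q; first by apply: q0; rewrite normr0.
exists M => //; near=> z.
have z1 : `|z| < 1 by near: z; exact: near_unit_disk.
rewrite !fctE fg // normrM mulrC ler_wpM2r //.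
by near: z.
Unshelve. all: by end_near. Qed.

Lemma inner_ratioE (s : seq C) (z : C) :
  (inner_num s).[z] / (inner_den s).[z] = \prod_(a <- s) ((z - a) / (1 - z * a^*)).
Proof.
rewrite /inner_num /inner_den !horner_prod -prodfV -big_split /=.
apply: eq_bigr => a _.
by rewrite hornerXsubC hornerD hornerN hornerZ hornerX hornerC [_^* * z]mulrC.
Qed.

Lemma blaschke_productP k (B : C^o -> C^o) : blaschke_product k B <->
  exists gamma s, [/\ `|gamma| = 1, size s = k, all (fun a => `|a| < 1) s
    & forall z : C, `|z| < 1 ->
        B z = gamma * ((inner_num s).[z] / (inner_den s).[z])].
Proof.
split=> [[gamma [a [gamma1 a1 BE]]]|[gamma [s [gamma1 <- s1 BE]]]].
  exists gamma, (codom a); split=> //.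
  - by rewrite size_codom card_ord.
  - by apply/allP => _ /codomP[j ->].
  - by move=> z z1; rewrite BE // inner_ratioE big_image.
exists gamma, (fun j => s`_j); split=> //.
- by move=> j; apply: (allP s1); apply: mem_nth.
- by move=> z z1; rewrite BE // inner_ratioE (big_nth 0) big_mkord.
Qed.

Lemma takagi_exists n kappa (w : {poly C}) : (kappa <= n.+1)%N ->
  num_neg_eigenvalues (1%:M - (toeplitz_upper n w)^t* *m toeplitz_upper n w) = kappa ->
  exists f B : C^o -> C^o,
    [/\ schur_class f, blaschke_product kappa B
      & (fun z => B z * w.[z]) = f +O_ (0 : C^o) (fun z => z ^+ n.+1)].
Proof.
rewrite num_neg_toeplitz leq_eqVlt => /orP[/eqP -> _|kn kE].
  (* In the extreme case [kappa = n+1], the Blaschke product [z^(n+1)] makes [f = 0] a solution. *)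
  exists (cst 0), (fun z => z ^+ n.+1); split.
  - split=> [z _|z _]; first exact: derivable_cst.
    by rewrite normr0 ler01.
  - apply/blaschke_productP; exists 1, (nseq n.+1 0); split.
    + by rewrite normr1.
    + by rewrite size_nseq.
    + by rewrite all_nseq normr0 ltr01 orbT.
    move=> z z1; rewrite mul1r /inner_num /inner_den !big_nseq !iter_mulr_1.
    by rewrite conjC0 scale0r !subr0 expr1n hornerXn hornerC divr1.
  apply: (@bigO_rational _ _ _ w 1) => z z1; first by rewrite hornerC oner_neq0.
  by rewrite hornerC divr1 subr0.
have [c [s [r [u [/andP[c0 c1] [sk s1] [r0 [sr r1]] [su wu] uE]]]]] := takagi_pair kE kn.
set x := inner_num s * r in wu uE.
(* [d] extra zeros at the origin bring the Blaschke product to degree [kappa]. Reflecting the disk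
   zeros of [x] gives [g], which has the modulus of [x] on the circle but no zeros in the disk, and
   [f] is [z^d u / g]. *)
pose d := (kappa - size s)%N; pose g := inner_den s * r.
pose s' := s ++ nseq d (0 : C).
have num' : inner_num s' = inner_num s * 'X^d.
  by rewrite /inner_num big_cat big_nseq iter_mulr_1 subr0.
have den' : inner_den s' = inner_den s.
  by rewrite /inner_den big_cat big_nseq iter_mulr_1 conjC0 scale0r subr0 expr1n /= mulr1.
have g1 (z : C) : `|z| < 1 -> g.[z] != 0.
  by move=> z1; rewrite hornerM mulf_neq0 ?r1 ?inner_den_neq0.
have [m nE] : exists m, n = (size s + m)%N.
  by exists (n - size s)%N; rewrite subnKC //; move: r0; rewrite -size_poly_gt0; lia.
have sr' : (size r <= m.+1)%N by lia.
have sd : (size (inner_den s) <= (size s).+1)%N by rewrite -revp_inner_num size_revp.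
have sg : (size g <= n.+1)%N.
  by rewrite (leq_trans (size_polyMleq _ _)) // nE; lia.
have gE : g * revp n g = x * revp n x.
  rewrite nE /g /x !revpM ?size_inner_num // revp_inner_num -(revp_inner_num s).
  rewrite revpK ?size_inner_num //; ring.
exists (fun z => ('X^d * u).[z] / g.[z]).
exists (fun z => (inner_num s').[z] / (inner_den s').[z]); split.
- split=> z z1; first exact/derivable_ratioC/g1.
  rewrite normrM normfV ler_pdivrMr ?normr_gt0 ?g1 // mul1r.
  rewrite hornerM hornerXn normrM normrX.
  apply: (@le_trans _ _ `|u.[z]|); first by rewrite ler_piMl // exprn_ile1 ?normr_ge0 ?ltW.
  rewrite -(ler_pXn2r (n := 2)) ?nnegrE //.
  apply: (le_trans (norm_le_of_revp_eq c0 su sg _ g1 z1)); first by rewrite uE gE.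
  by rewrite ler_piMl // exprn_ge0.
- apply/blaschke_productP; exists 1, s'; split.
  + by rewrite normr1.
  + by rewrite size_cat size_nseq subnKC.
  + by rewrite all_cat s1 all_nseq normr0 ltr01 orbT.
  + by move=> z _; rewrite mul1r.
(* From [w x = u + h z^(n+1)] one gets [B w - f = z^(n+1) (z^d h / g)]. *)
have [h hE] := wu.
apply: (@bigO_rational _ _ _ ('X^d * h) g) => // z z1.
have := congr1 (horner^~ z) hE; rewrite /x /= !hornerM hornerD hornerM => hz.
have rz : r.[z] != 0 by apply: r1.
have dz : (inner_den s).[z] != 0 by apply: inner_den_neq0.
rewrite num' den' /g !hornerM !hornerXn.
rewrite hornerXn in hz.
have -> : u.[z] = w.[z] * ((inner_num s).[z] * r.[z]) - h.[z] * z ^+ n.+1.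
  by rewrite hz addrK.
by field; rewrite rz dz.
Qed.

End Sufficiency.

(** * Complex line integrals and Goursat's theorem *)

Section ComplexIntegral.
Local Open Scope complex_scope.
Local Open Scope classical_set_scope.
Variable R : realType.
Local Notation C := R[i].
Local Notation mu := (@lebesgue_measure R).
Implicit Types (a b c : R) (f g : R -> R) (phi psi : R -> C).

Lemma normc_real (x : R) : `|x%:C| = `|x|%:C.
Proof. by rewrite normc_def /= expr0n /= addr0 sqrtr_sqr. Qed.

Lemma normc_i : `|'i%C : C| = 1.
Proof. by rewrite normc_def /= expr0n /= expr1n add0r sqrtr1. Qed.

Lemma normc_ReIm (z : C) : `|z| <= (`|complex.Re z| + `|complex.Im z|)%:C.
Proof.
rewrite {1}[z]complexE (le_trans (ler_normD _ _)) // normrM normc_i mul1r.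
by rewrite !normc_real -rmorphD.
Qed.

Lemma Re_le_normc (z : C) : (`|complex.Re z|)%:C <= `|z|.
Proof.
rewrite normc_def lecR -sqrtr_sqr ler_wsqrtr // lerDl sqr_ge0 //.
Qed.

Lemma Im_le_normc (z : C) : (`|complex.Im z|)%:C <= `|z|.
Proof.
rewrite normc_def lecR -sqrtr_sqr ler_wsqrtr // lerDr sqr_ge0 //.
Qed.

Lemma pos_normcP (e : C) : 0 < e -> exists2 r : R, 0 < r & e = r%:C.
Proof.
by case: e => x y; rewrite ltcE /= => /andP[/eqP -> x0]; exists x.
Qed.

Definition cts phi := fun x => {for x, continuous (phi : R -> C^o)}.

Lemma cts_ReP phi x : cts phi x -> {for x, continuous (fun y => complex.Re (phi y))}.
Proof.
move=> /cvgrPdist_lt H; apply/cvgrPdist_lt => e e0.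
have := H e%:C; rewrite ltcR => /(_ e0); apply: filterS => y.
by rewrite -ltcR; apply: le_lt_trans; rewrite -raddfB; apply: Re_le_normc.
Qed.

Lemma cts_ImP phi x : cts phi x -> {for x, continuous (fun y => complex.Im (phi y))}.
Proof.
move=> /cvgrPdist_lt H; apply/cvgrPdist_lt => e e0.
have := H e%:C; rewrite ltcR => /(_ e0); apply: filterS => y.
by rewrite -ltcR; apply: le_lt_trans; rewrite -raddfB; apply: Im_le_normc.
Qed.

Lemma cts_Complex f g x : {for x, continuous f} -> {for x, continuous g} ->
  cts (fun y => f y +i* g y) x.
Proof.
move=> /cvgrPdist_lt Hf /cvgrPdist_lt Hg; apply/cvgrPdist_lt => _ /pos_normcP[e e0 ->].
have e2 : 0 < e / 2 by rewrite divr_gt0.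
have := Hf _ e2; have := Hg _ e2; apply: filterS2 => y gy fy.
apply: le_lt_trans (normc_ReIm _) _; rewrite ltcR /=.
by rewrite [e]splitr ltrD.
Qed.

Definition intR a b f : R := \int[mu]_(x in `[a, b]) f x.

Definition contR a b f := forall x, a <= x <= b -> {for x, continuous f}.

Lemma contR_integrable a b f : contR a b f -> mu.-integrable `[a, b] (EFin \o f).
Proof.
move=> cf; apply: continuous_compact_integrable; first exact: segment_compact.
by apply: continuous_in_subspaceT => x; rewrite inE /= in_itv /= => /cf.
Qed.

Lemma intR_cst a b (k : R) : a <= b -> intR a b (cst k) = k * (b - a).
Proof.
move=> ab; rewrite /intR Rintegral_cst //= lebesgue_measure_itv /= lte_fin.
move: ab; rewrite le_eqVlt => /orP[/eqP ->|->]; last by rewrite -EFinB.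
by rewrite ltxx subrr.
Qed.

Lemma intRD a b f g : contR a b f -> contR a b g ->
  intR a b (f \+ g) = intR a b f + intR a b g.
Proof. by move=> cf cg; apply: RintegralD => //; apply: contR_integrable. Qed.

Lemma intRB a b f g : contR a b f -> contR a b g ->
  intR a b (f \- g) = intR a b f - intR a b g.
Proof. by move=> cf cg; apply: RintegralB => //; apply: contR_integrable. Qed.

Lemma intRZ a b f k : contR a b f -> intR a b (fun x => k * f x) = k * intR a b f.
Proof. by move=> cf; apply: RintegralZl => //; apply: contR_integrable. Qed.

Lemma eq_intR a b f g : (forall x, a <= x <= b -> f x = g x) -> intR a b f = intR a b g.
Proof.
by move=> fg; apply: eq_Rintegral => x; rewrite inE /= in_itv /=; apply: fg.
Qed.

Lemma le_intR a b f g : contR a b f -> contR a b g ->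
  (forall x, a <= x <= b -> f x <= g x) -> intR a b f <= intR a b g.
Proof.
by move=> cf cg fg; apply: le_Rintegral => //; apply: contR_integrable.
Qed.

Lemma intR_chasles a b c f : a <= b <= c -> contR a c f ->
  intR a c f = intR a b f + intR b c f.
Proof.
move=> /andP[ab bc] cf; apply/eqP; rewrite addrC -subr_eq; apply/eqP.
rewrite /intR Rintegral_itvB ?bnd_simp //; last exact: contR_integrable.
rewrite Rintegral_itv_obnd_cbnd //.
have : mu.-integrable `[b, c] (EFin \o f).
  by apply: contR_integrable => x /andP[bx xc]; apply: cf; rewrite xc (le_trans ab).
by apply: integrableS => //; apply: subset_itv_oc_cc.
Qed.

Definition intC a b phi : C :=
  intR a b (fun x => complex.Re (phi x)) +i* intR a b (fun x => complex.Im (phi x)).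

Definition contC a b phi := forall x, a <= x <= b -> cts phi x.

Lemma contC_Re a b phi : contC a b phi -> contR a b (fun x => complex.Re (phi x)).
Proof. by move=> c x /c /cts_ReP. Qed.

Lemma contC_Im a b phi : contC a b phi -> contR a b (fun x => complex.Im (phi x)).
Proof. by move=> c x /c /cts_ImP. Qed.

Lemma contCD a b phi psi : contC a b phi -> contC a b psi -> contC a b (phi \+ psi).
Proof. by move=> c1 c2 x xab; apply: cvgD; [apply: c1|apply: c2]. Qed.

Lemma contCB a b phi psi : contC a b phi -> contC a b psi -> contC a b (phi \- psi).
Proof. by move=> c1 c2 x xab; apply: cvgB; [apply: c1|apply: c2]. Qed.

Lemma contCM a b phi psi : contC a b phi -> contC a b psi ->
  contC a b (fun x => phi x * psi x).
Proof. by move=> c1 c2 x xab; apply: cvgM; [apply: c1|apply: c2]. Qed.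

Lemma contC_cst a b (k : C) : contC a b (cst k).
Proof. by move=> x xab; apply: cvg_cst. Qed.

Lemma contC_conj a b phi : contC a b phi -> contC a b (fun x => (phi x)^*%R).
Proof.
move=> cp x xab; have -> : (fun x => (phi x)^*%R) =
    (fun y => complex.Re (phi y) +i* (- complex.Im (phi y))).
  by apply/funext => y; case: (phi y).
apply: cts_Complex; first by apply: cts_ReP; apply: cp.
by apply: cvgN; apply: cts_ImP; apply: cp.
Qed.

Lemma eq_intC a b phi psi : (forall x, a <= x <= b -> phi x = psi x) ->
  intC a b phi = intC a b psi.
Proof. by move=> E; congr (_ +i* _); apply: eq_intR => x /E ->. Qed.

Lemma intCD a b phi psi : contC a b phi -> contC a b psi ->
  intC a b (phi \+ psi) = intC a b phi + intC a b psi.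
Proof.
move=> c1 c2; rewrite /intC.
rewrite (_ : (fun x => complex.Re _) =
  (fun x => complex.Re (phi x)) \+ (fun x => complex.Re (psi x))); last first.
  by apply/funext => x /=; rewrite raddfD.
rewrite (_ : (fun x => complex.Im ((phi \+ psi) x)) =
  (fun x => complex.Im (phi x)) \+ (fun x => complex.Im (psi x))); last first.
  by apply/funext => x /=; rewrite raddfD.
by rewrite (intRD (contC_Re c1) (contC_Re c2)) (intRD (contC_Im c1) (contC_Im c2)).
Qed.

Lemma intCZ a b phi (k : C) : contC a b phi ->
  intC a b (fun x => k * phi x) = k * intC a b phi.
Proof.
move=> cp; have cr := contC_Re cp; have ci := contC_Im cp.
have cz f l : contR a b f -> contR a b (fun x => l * f x).
  by move=> cf x xab; apply: cvgM; [apply: cvg_cst|apply: cf].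
rewrite /intC; case: k => k l.
rewrite (_ : (fun x => complex.Re _) =
  (fun x => k * complex.Re (phi x)) \- (fun x => l * complex.Im (phi x))); last first.
  by apply/funext => x /=; case: (phi x).
rewrite (_ : (fun x => complex.Im ((k +i* l) * phi x)) =
  (fun x => k * complex.Im (phi x)) \+ (fun x => l * complex.Re (phi x))); last first.
  by apply/funext => x /=; case: (phi x).
by rewrite intRB ?intRD ?intRZ //; apply: cz.
Qed.

Lemma intCB a b phi psi : contC a b phi -> contC a b psi ->
  intC a b (phi \- psi) = intC a b phi - intC a b psi.
Proof.
move=> c1 c2; have -> : phi \- psi = phi \+ (fun x => (-1) * psi x).
  by apply/funext => x /=; rewrite mulN1r.
have c3 : contC a b (fun x => (-1) * psi x).
  exact: (contCM (@contC_cst a b (-1)) c2).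
by rewrite (intCD c1 c3) (intCZ _ c2) mulN1r.
Qed.

Lemma intC_cst a b (k : C) : a <= b -> intC a b (cst k) = k * (b - a)%:C.
Proof.
move=> ab; rewrite /intC !intR_cst //; case: k => x y /=.
by apply/eqP; rewrite eq_complex /=; apply/andP; split; apply/eqP; ring.
Qed.

Lemma intC_chasles a b c phi : a <= b <= c -> contC a c phi ->
  intC a c phi = intC a b phi + intC b c phi.
Proof.
move=> abc cp; rewrite /intC (@intR_chasles a b c) ?(@intR_chasles a b c (fun x => complex.Im _)) //.
- exact: contC_Im.
- exact: contC_Re.
Qed.

Lemma norm_intR_le a b f (M : R) : a <= b -> contR a b f ->
  (forall x, a <= x <= b -> `|f x| <= M) -> `|intR a b f| <= M * (b - a).
Proof.
move=> ab cf fM; rewrite ler_norml -mulNr -!intR_cst //.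
by rewrite !le_intR // => [x _|x /fM|x _|x /fM]; try exact: cvg_cst; rewrite ler_norml => /andP[].
Qed.

(** The factor 2 comes from estimating the real and imaginary parts separately; the applications
    tolerate this loss. *)
Lemma norm_intC_le a b phi (M : R) : a <= b -> contC a b phi ->
  (forall x, a <= x <= b -> `|phi x| <= M%:C) ->
  `|intC a b phi| <= (2 * M * (b - a))%:C.
Proof.
move=> ab cp pM; apply: le_trans (normc_ReIm _) _; rewrite lecR /=.
rewrite -mulrA mulrDl mul1r lerD // norm_intR_le //.
- exact: contC_Re.
- by move=> x /pM; rewrite -lecR; apply: le_trans; apply: Re_le_normc.
- exact: contC_Im.
- by move=> x /pM; rewrite -lecR; apply: le_trans; apply: Im_le_normc.
Qed.

End ComplexIntegral.

(** The field is generic so as to serve both the real functions [expR], [cos], [sin] and complex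
    differentiable functions. *)
Lemma is_derive_approx (K : numFieldType) (f : K^o -> K^o) (z : K^o) (D : K) :
  is_derive z 1 f D -> forall e : K, 0 < e -> exists2 d : K, 0 < d &
    forall y : K, `|y - z| < d -> `|f y - f z - D * (y - z)| <= e * `|y - z|.
Proof.
move=> [/derivable_nbhs/eqaddoP H <-] e e0.
have /nbhs_norm0P[d d0 Hd] := H e e0; exists d => // y yz.
have := Hd (y - z) yz; rewrite !fctE /= opprD addrA.
by rewrite -[(y - z) *: 1]/((y - z) * 1) mulr1 subrK [_ *: 'D_1 f z]mulrC.
Qed.

Lemma approx_derivable (K : numFieldType) (f : K^o -> K^o) (z : K^o) (D : K) :
  (forall e : K, 0 < e -> exists2 d : K, 0 < d &
    forall h : K, `|h| < d -> `|f (h + z) - f z - D * h| <= e * `|h|) ->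
  derivable f z 1.
Proof.
move=> H; apply/cvg_ex; exists D; apply/cvgrPdist_le => e e0.
have [d d0 Hd] := H e e0; rewrite near_withinE.
apply/(@nbhs_norm0P K K^o); exists d => // h /= hd h0.
have := Hd h hd; rewrite -[h *: 1]/(h * 1) mulr1 => Hh.
have -> : D - h^-1 *: (f (h + z) - f z) = - h^-1 * (f (h + z) - f z - D * h).
  by rewrite -[h^-1 *: _]/(h^-1 * _); field.
by rewrite normrM normrN normfV ler_pdivrMl ?normr_gt0 // [`|h| * e]mulrC.
Qed.

Section Goursat.
Local Open Scope complex_scope.
Local Open Scope classical_set_scope.
Variable R : realType.
Local Notation C := R[i].
Implicit Types (a b c d s t m : R).

(** The norm on [R[i]] takes values in [R[i]]; this is the modulus as an element of the totally
    ordered field [R]. *)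
Definition cabs (z : C) : R := complex.Re `|z|.

Lemma cabsE (z : C) : `|z| = (cabs z)%:C.
Proof. by rewrite /cabs normc_def. Qed.

Lemma cabs_ge0 z : 0 <= cabs z.
Proof. by rewrite -ler0c -cabsE. Qed.

Lemma derivable_cts (H : C^o -> C^o) (z : C) : derivable H z 1 -> {for z, continuous H}.
Proof. by move=> /derivable1_diffP/differentiable_continuous. Qed.

Lemma cts_horizontal c s : cts (fun s => s +i* c) s.
Proof. by apply: cts_Complex; [exact: cvg_id|exact: cvg_cst]. Qed.

Lemma cts_vertical c s : cts (fun t => c +i* t) s.
Proof. by apply: cts_Complex; [exact: cvg_cst|exact: cvg_id]. Qed.

Section Rectangle.
Variables (H : C^o -> C^o) (a0 b0 c0 d0 : R).
Hypothesis dH : forall s t, a0 <= s <= b0 -> c0 <= t <= d0 -> derivable H (s +i* t) 1.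

Lemma contC_horizontal a b t : a0 <= a -> b <= b0 -> c0 <= t <= d0 ->
  contC a b (fun s => H (s +i* t)).
Proof.
move=> aa bb tt s /andP[as_ sb].
apply: (@continuous_comp _ _ _ (fun s => (s +i* t : C^o))); first exact: cts_horizontal.
by apply/derivable_cts/dH => //; rewrite (le_trans aa) // (le_trans sb).
Qed.

Lemma contC_vertical c d s : c0 <= c -> d <= d0 -> a0 <= s <= b0 ->
  contC c d (fun t => H (s +i* t)).
Proof.
move=> cc dd ss t /andP[ct td].
apply: (@continuous_comp _ _ _ (fun t => (s +i* t : C^o))); first exact: cts_vertical.
by apply/derivable_cts/dH => //; rewrite (le_trans cc) // (le_trans td).
Qed.

(** The contour integral of [H] along the counterclockwise boundary of the rectangle [[a, b] x
    [c, d]]. *)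
Definition boundary a b c d : C :=
  intC a b (fun s => H (s +i* c)) + 'i%C * intC c d (fun t => H (b +i* t))
  - intC a b (fun s => H (s +i* d)) - 'i%C * intC c d (fun t => H (a +i* t)).

Lemma boundary_split_h a m b c d : a0 <= a <= m -> m <= b <= b0 ->
  c0 <= c <= d -> d <= d0 ->
  boundary a b c d = boundary a m c d + boundary m b c d.
Proof.
move=> /andP[aa am] /andP[mb bb] /andP[cc cd] dd; rewrite /boundary.
have am_b : a <= m <= b by rewrite am.
rewrite (intC_chasles am_b (contC_horizontal aa bb _)); last by rewrite cc (le_trans cd).
rewrite (intC_chasles am_b (contC_horizontal aa bb _)); last by rewrite dd (le_trans cc).
by ring.
Qed.

Lemma boundary_split_v a b c m d : a0 <= a <= b -> b <= b0 ->
  c0 <= c <= m -> m <= d <= d0 ->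
  boundary a b c d = boundary a b c m + boundary a b m d.
Proof.
move=> /andP[aa ab] bb /andP[cc cm] /andP[md dd]; rewrite /boundary.
have cm_d : c <= m <= d by rewrite cm.
rewrite (intC_chasles cm_d (contC_vertical cc dd _)); last by rewrite bb (le_trans aa).
rewrite (intC_chasles cm_d (contC_vertical cc dd _)); last by rewrite aa (le_trans ab).
by ring.
Qed.

Lemma norm_intC_cst_le a b (f : R -> C) (k : C) (M : R) : a <= b -> contC a b f ->
  (forall x, a <= x <= b -> `|f x - k| <= M%:C) ->
  `|intC a b f - k * (b - a)%:C| <= (2 * M * (b - a))%:C.
Proof.
move=> ab cf fM; have ck : contC a b (cst k) by apply: contC_cst.
by rewrite -(intC_cst k ab) -(intCB cf ck); apply: (norm_intC_le ab (contCB cf ck)).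
Qed.

(* The affine approximation has zero boundary integral, so only the error
   term contributes. *)
Lemma boundary_le a b c d (z0 D : C) (e : R) : a0 <= a <= b -> b <= b0 ->
  c0 <= c <= d -> d <= d0 -> 0 <= e ->
  (forall s t, a <= s <= b -> c <= t <= d ->
    `|H (s +i* t) - H z0 - D * ((s +i* t) - z0)| <= (e * ((b - a) + (d - c)))%:C) ->
  `|boundary a b c d| <= (4 * e * ((b - a) + (d - c)) ^+ 2)%:C.
Proof.
move=> /andP[aa ab] bb /andP[cc cd] dd e0 HD; set l := (b - a) + (d - c) in HD *.
have cin : c <= c <= d by rewrite lexx.
have din : c <= d <= d by rewrite lexx andbT.
have ain : a <= a <= b by rewrite lexx.
have bin : a <= b <= b by rewrite lexx andbT.
have c1 : contC a b (fun s => H (s +i* c)).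
  by apply: contC_horizontal => //; rewrite cc (le_trans cd).
have c2 : contC a b (fun s => H (s +i* d)).
  by apply: contC_horizontal => //; rewrite dd (le_trans cc).
have c3 : contC c d (fun t => H (b +i* t)).
  by apply: contC_vertical => //; rewrite bb (le_trans aa).
have c4 : contC c d (fun t => H (a +i* t)).
  by apply: contC_vertical => //; rewrite aa (le_trans ab).
(* Increments of the affine part [D z] between opposite sides: bottom minus top, and right minus
   left. Their contributions [k1 (b - a)] and ['i k2 (d - c)] cancel. *)
pose k1 := D * (0 +i* (c - d)); pose k2 := D * (b - a)%:C.
have diff (z w : C) : `|H z - H z0 - D * (z - z0)| <= (e * l)%:C ->
    `|H w - H z0 - D * (w - z0)| <= (e * l)%:C ->
    `|H z - H w - D * (z - w)| <= (2 * (e * l))%:C.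
  move=> hz hw; rewrite mulrDl mul1r rmorphD /=.
  have -> : H z - H w - D * (z - w) =
      (H z - H z0 - D * (z - z0)) - (H w - H z0 - D * (w - z0)) by ring.
  by rewrite (le_trans (ler_normB _ _)) // lerD.
have e1 := norm_intC_cst_le (k := k1) (M := 2 * (e * l)) ab (contCB c1 c2).
have e2 := norm_intC_cst_le (k := k2) (M := 2 * (e * l)) cd (contCB c3 c4).
rewrite (intCB c1 c2) in e1; rewrite (intCB c3 c4) in e2.
have {}e1 := e1 _; have {}e2 := e2 _.
have -> : boundary a b c d =
  (intC a b (fun s => H (s +i* c)) - intC a b (fun s => H (s +i* d)) - k1 * (b - a)%:C)
  + 'i%C * (intC c d (fun t => H (b +i* t)) - intC c d (fun t => H (a +i* t)) - k2 * (d - c)%:C).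
  have -> : k1 = - 'i%C * D * (d - c)%:C.
    rewrite /k1 (_ : 0 +i* (c - d) = - ('i%C * (d - c)%:C)); first by ring.
    by apply/eqP; rewrite eq_complex /=; apply/andP; split; apply/eqP; ring.
  by rewrite /boundary /k2; ring.
rewrite (le_trans (ler_normD _ _)) // normrM normc_i mul1r.
(* One factor 2 comes from subtracting two approximations, the other from the crude bound on complex
   integrals. *)
have -> : 4 * e * l ^+ 2 = 2 * (2 * (e * l)) * (b - a) + 2 * (2 * (e * l)) * (d - c).
  by rewrite /l; ring.
rewrite [X in _ <= X]rmorphD /= lerD //.
- apply: e1 => s sab /=.
  have -> : k1 = D * ((s +i* c) - (s +i* d)).
    by rewrite /k1; congr (_ * _); apply/eqP; rewrite eq_complex /= subrr !eqxx.
  by apply: diff; apply: HD.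
- apply: e2 => t tcd /=.
  have -> : k2 = D * ((b +i* t) - (a +i* t)).
    by rewrite /k2; congr (_ * _); apply/eqP; rewrite eq_complex /= subrr !eqxx.
  by apply: diff; apply: HD.
Qed.

End Rectangle.
End Goursat.

Section GoursatTheorem.
Local Open Scope complex_scope.
Local Open Scope classical_set_scope.
Variable R : realType.
Local Notation C := R[i].

Lemma cabsD (z w : C) : cabs (z + w) <= cabs z + cabs w.
Proof. by rewrite -lecR rmorphD /= -!cabsE ler_normD. Qed.

Lemma dist_le_length (u l x y : R) :
  u <= x <= u + l -> u <= y <= u + l -> `|x - y| <= l.
Proof. by move=> xu yu; rewrite ler_norml; lra. Qed.

Lemma exists_div_exp2_lt (l e : R) : 0 <= l -> 0 < e -> exists k, l / 2 ^+ k < e.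
Proof.
move=> l0 e0; have [k kl] : exists k : nat, l / e < k%:R.
  by exists (Num.bound (l / e)); apply: archi_boundP; rewrite divr_ge0 // ltW.
exists k; rewrite ltr_pdivrMr ?exprn_gt0 //.
move: kl; rewrite ltr_pdivrMr // mulrC => /lt_le_trans; apply.
rewrite ler_wpM2l ?(ltW e0) //.
by rewrite -natrX ler_nat ltnW // ltn_expl.
Qed.

Section Bisection.
Variables (H : C^o -> C^o) (a b c d : R).
Hypotheses (ab : a <= b) (cd : c <= d).
Hypothesis dH : forall s t, a <= s <= b -> c <= t <= d -> derivable H (s +i* t) 1.

Let w k := (b - a) / 2 ^+ k.
Let h k := (d - c) / 2 ^+ k.

(** A rectangle of generation [k] is encoded by its lower left corner [p], its sides [w k] and [h k]
    being determined by [k]. *)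
Let inside k (p : R * R) :=
  [/\ a <= p.1, p.1 + w k <= b, c <= p.2 & p.2 + h k <= d].

Let bd k (p : R * R) := cabs (boundary H p.1 (p.1 + w k) p.2 (p.2 + h k)).

Let refines k (p q : R * R) :=
  [/\ inside k.+1 q, p.1 <= q.1 /\ q.1 + w k.+1 <= p.1 + w k,
     p.2 <= q.2 /\ q.2 + h k.+1 <= p.2 + h k & bd k p <= 4 * bd k.+1 q].

Let half_step (l : R) k : l / 2 ^+ k = l / 2 ^+ k.+1 + l / 2 ^+ k.+1.
Proof.
have k0 : (2 : R) ^+ k != 0 by rewrite expf_neq0 // pnatr_eq0.
by rewrite exprS; field; rewrite k0.
Qed.

(** The integral is the sum over the four quarters, so one quarter carries at least a fourth of its
    modulus. *)
Let bisection_step k p : inside k p -> exists q, refines k p q.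
Proof.
case: p => s t [/= as_ sb ct td].
have w0 : 0 <= w k.+1 by rewrite divr_ge0 ?exprn_ge0 // subr_ge0.
have h0 : 0 <= h k.+1 by rewrite divr_ge0 ?exprn_ge0 // subr_ge0.
have wk : w k = w k.+1 + w k.+1 by apply: half_step.
have hk : h k = h k.+1 + h k.+1 by apply: half_step.
rewrite wk in sb; rewrite hk in td.
set w1 := w k.+1 in w0 wk sb *; set h1 := h k.+1 in h0 hk td *.
have choose x y : 0 <= x <= w1 -> 0 <= y <= h1 ->
    bd k (s, t) <= 4 * bd k.+1 (s + x, t + y) -> exists q, refines k (s, t) q.
  move=> xw yh bq; exists (s + x, t + y); split=> //; last 2 first.
  - by move=> {bq} /=; rewrite -/w1 wk; split; lra.
  - by move=> {bq} /=; rewrite -/h1 hk; split; lra.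
  - by move=> {bq}; split; rewrite /= -/w1 -/h1; lra.
have r0 : (0 : R) <= 0 <= w1 by apply/andP; split.
have r1 : 0 <= w1 <= w1 by apply/andP; split.
have u0 : (0 : R) <= 0 <= h1 by apply/andP; split.
have u1 : 0 <= h1 <= h1 by apply/andP; split.
have sum : bd k (s, t) <= bd k.+1 (s + 0, t + 0) + bd k.+1 (s + w1, t + 0)
    + (bd k.+1 (s + 0, t + h1) + bd k.+1 (s + w1, t + h1)).
  rewrite /bd /= wk hk !addr0 ![_ + (_ + _)]addrA.
  rewrite (@boundary_split_v _ H a b c d dH s _ t (t + h1)); try lra.
  rewrite (@boundary_split_h _ H a b c d dH s (s + w1) _ t (t + h1)); try lra.
  rewrite (@boundary_split_h _ H a b c d dH s (s + w1) _ (t + h1)); try lra.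
  by rewrite -/w1 -/h1 (le_trans (cabsD _ _)) // -[X in _ <= X]addrA lerD // cabsD.
have [l1|l1] := leP (bd k (s, t)) (4 * bd k.+1 (s + 0, t + 0)); first exact: (choose 0 0).
have [l2|l2] := leP (bd k (s, t)) (4 * bd k.+1 (s + w1, t + 0)); first exact: (choose w1 0).
have [l3|l3] := leP (bd k (s, t)) (4 * bd k.+1 (s + 0, t + h1)); first exact: (choose 0 h1).
have [l4|l4] := leP (bd k (s, t)) (4 * bd k.+1 (s + w1, t + h1)); first exact: (choose w1 h1).
move: sum l1 l2 l3 l4.
move: (bd k _) (bd _ (s + 0, _)) (bd _ (s + w1, _)) (bd _ (s + 0, _)) (bd _ (s + w1, _)).
by clear=> *; lra.
Qed.

Let nested (u : nat -> R) (l : nat -> R) : (forall k, 0 <= l k) ->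
  (forall k, u k <= u k.+1) -> (forall k, u k.+1 + l k.+1 <= u k + l k) ->
  exists x, forall k, u k <= x <= u k + l k.
Proof.
move=> l0 u1 u2.
have uM : {homo u : m n / (m <= n)%N >-> m <= n}.
  by apply/nondecreasing_seqP.
have lM : {homo (fun k => u k + l k) : m n / (m <= n)%N >-> n <= m}.
  by apply/nonincreasing_seqP.
have ub j k : u j <= u k + l k.
  have [jk|kj] := leqP j k; first by rewrite (le_trans (uM _ _ jk)) // lerDl.
  by rewrite (le_trans _ (lM _ _ (ltnW kj))) // lerDl.
exists (sup (range u)) => k; apply/andP; split.
  by apply: ub_le_sup; [exists (u 0%N + l 0%N) => _ [j _ <-]|exists k].
by apply: ge_sup; [exists (u k); exists k|move=> _ [j _ <-]].
Qed.

Theorem goursat : boundary H a b c d = 0.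
Proof.
(* Choice asks for a value at every argument; [(0, 0)] fills in where [inside] fails. *)
have /choice[f fP] : forall x : nat * (R * R), exists q, inside x.1 x.2 -> refines x.1 x.2 q.
  move=> [k p]; have [ip|ip] := pselect (inside k p); last by exists (0, 0).
  by have [q pq] := bisection_step ip; exists q.
pose p := fix p k := if k is k'.+1 then f (k', p k') else (a, c).
have w00 : w 0%N = b - a by rewrite /w expr0 divr1.
have h00 : h 0%N = d - c by rewrite /h expr0 divr1.
have ip k : inside k (p k).
  elim: k => [|k /(fP (k, p k))[]//].
  by split; rewrite /= ?w00 ?h00 ?lexx // addrC subrK.
have rp k : refines k (p k) (p k.+1) by apply: (fP (k, p k)).
have w0 k : 0 <= w k by rewrite divr_ge0 ?exprn_ge0 // subr_ge0.
have h0 k : 0 <= h k by rewrite divr_ge0 ?exprn_ge0 // subr_ge0.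
have [s sP] : exists s, forall k, (p k).1 <= s <= (p k).1 + w k.
  by apply: nested => // k; case: (rp k) => _ [].
have [t tP] : exists t, forall k, (p k).2 <= t <= (p k).2 + h k.
  by apply: nested => // k; case: (rp k) => _ _ [].
have bdk k : bd 0 (a, c) <= 4 ^+ k * bd k (p k).
  elim: k => [|k IH]; first by rewrite expr0 mul1r.
  rewrite (le_trans IH) // exprSr -mulrA ler_wpM2l ?exprn_ge0 //.
  by case: (rp k).
have bd0 : bd 0 (a, c) = cabs (boundary H a b c d).
  by rewrite /bd /= w00 h00 ![_ + (_ - _)]addrC !subrK.
have [D HD] : exists D : C, forall e : C, 0 < e -> exists2 r : C, 0 < r &
    forall y : C, `|y - (s +i* t)| < r ->
      `|H y - H (s +i* t) - D * (y - (s +i* t))| <= e * `|y - (s +i* t)|.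
  exists ('D_1 H (s +i* t)); apply: is_derive_approx; apply: derivableP; apply: dH.
    by have := sP 0%N; rewrite /= w00; lra.
  by have := tP 0%N; rewrite /= h00; lra.
pose l := (b - a) + (d - c).
have l0 : 0 <= l by rewrite addr_ge0 // subr_ge0.
(* Near the common point of the nested rectangles, the generation [k] integral is at most
   [4 e (l / 2^k)^2], and the factor [4^k] lost in bisecting cancels exactly. *)
have small e : 0 < e -> cabs (boundary H a b c d) <= e * (4 * l ^+ 2).
  move=> e0; have [_ /pos_normcP[r r0 ->] Hr] : exists2 r : C, 0 < r &
    forall y : C, `|y - (s +i* t)| < r ->
      `|H y - H (s +i* t) - D * (y - (s +i* t))| <= e%:C * `|y - (s +i* t)|.
    by apply: HD; rewrite ltcR.
  have [k kr] := exists_div_exp2_lt l0 r0.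
  have wh : w k + h k = l / 2 ^+ k by rewrite /w /h -mulrDl.
  have [i1 i2 i3 i4] := ip k; have sk := sP k; have tk := tP k.
  have wk := w0 k; have hk := h0 k.
  have bk : bd k (p k) <= 4 * e * (l / 2 ^+ k) ^+ 2.
    rewrite -lecR -cabsE -wh.
    have Ew : (p k).1 + w k - (p k).1 = w k by rewrite addrC addKr.
    have Eh : (p k).2 + h k - (p k).2 = h k by rewrite addrC addKr.
    rewrite -{2}Ew -{2}Eh; apply: (boundary_le dH (z0 := s +i* t) (D := D));
      rewrite ?i1 ?i2 ?i3 ?i4 ?lerDl ?(ltW e0) //.
    rewrite Ew Eh => x y xk yk.
    have xy : `|(x +i* y) - (s +i* t)| <= (w k + h k)%:C.
      apply: le_trans (normc_ReIm _) _; rewrite lecR /=.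
      by rewrite lerD // ?(dist_le_length xk sk) ?(dist_le_length yk tk).
    have xyr : `|(x +i* y) - (s +i* t)| < r%:C.
      by apply: le_lt_trans xy _; rewrite ltcR wh.
    by rewrite (le_trans (Hr _ xyr)) // rmorphM ler_wpM2l // ler0c ltW.
  rewrite -bd0 (le_trans (bdk k)) //.
  rewrite (le_trans (ler_wpM2l _ bk)) ?exprn_ge0 //.
  have k0 : (2 : R) ^+ k != 0 by rewrite expf_neq0 // pnatr_eq0.
  have -> : (4 : R) ^+ k = 2 ^+ k * 2 ^+ k by rewrite -exprMn -natrM.
  rewrite (_ : _ * (4 * e * _) = e * (4 * l ^+ 2)) //.
  by field; rewrite k0.
apply/eqP; rewrite -normr_eq0 cabsE -(rmorph0 (real_complex R)).
apply/eqP; congr _%:C; apply/le_anti; rewrite cabs_ge0 andbT.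
apply/ler_addgt0Pl => e e0; rewrite addr0.
have e1 : 0 < e / (4 * l ^+ 2 + 1) by rewrite divr_gt0 // ltr_wpDl // mulr_ge0 // exprn_ge0.
apply: le_trans (small _ e1) _.
rewrite mulrAC ler_pdivrMr; last by rewrite ltr_wpDl // mulr_ge0 // exprn_ge0.
by rewrite ler_wpM2l ?(ltW e0) // lerDl.
Qed.

End Bisection.
End GoursatTheorem.

(** * Circle integrals through the complex exponential *)

Section CircleIntegral.
Local Open Scope complex_scope.
Local Open Scope classical_set_scope.
Variable R : realType.
Local Notation C := R[i].

(** The complex exponential. It turns vertical segments of length [2 pi] into circles around 0, so
    Goursat's theorem on rectangles applies to functions on the punctured disk. *)
Definition expC (z : C) : C :=
  (expR (complex.Re z))%:C * (cos (complex.Im z) +i* sin (complex.Im z)).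

Lemma expCD z w : expC (z + w) = expC z * expC w.
Proof.
rewrite /expC !raddfD /= expRD rmorphM /= mulrACA; congr (_ * _).
apply/eqP; rewrite eq_complex /= cosD sinD; apply/andP; split; apply/eqP; ring.
Qed.

Lemma norm_expC z : `|expC z| = (expR (complex.Re z))%:C.
Proof.
rewrite /expC normrM normc_real normc_def /= cos2Dsin2 sqrtr1 mulr1.
by rewrite gtr0_norm ?expR_gt0.
Qed.

Lemma expC_approx0 (e : C) : 0 < e -> exists2 d : C, 0 < d &
  forall h : C, `|h| < d -> `|expC h - 1 - h| <= e * `|h|.
Proof.
move=> /pos_normcP[r r0 ->].
(* The errors below add up to [1 + 3 + 3 + 2 = 9] times [e0 * l], where [l] is the modulus of the
   increment. *)
pose e0 := Num.min 1 (r / 9).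
have e00 : 0 < e0 by rewrite lt_min ltr01 divr_gt0.
have e01 : e0 <= 1 by rewrite ge_min lexx.
have e0r : 9 * e0 <= r by rewrite -ler_pdivlMl // mulrC ge_min lexx orbT.
clearbody e0; have [d1 d10 H1] := is_derive_approx (is_derive_expR (0 : R)) e00.
have [d2 d20 H2] := is_derive_approx (is_derive_cos (0 : R)) e00.
have [d3 d30 H3] := is_derive_approx (is_derive_sin (0 : R)) e00.
pose d := Num.min e0 (Num.min d1 (Num.min d2 d3)).
exists d%:C; first by rewrite ltcR !lt_min e00 d10 d20.
case=> s t hd.
have sl : `|s| <= cabs (s +i* t) by rewrite -lecR -cabsE; apply: (Re_le_normc (s +i* t)).
have tl : `|t| <= cabs (s +i* t) by rewrite -lecR -cabsE; apply: (Im_le_normc (s +i* t)).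
rewrite cabsE ltcR in hd; rewrite [`|s +i* t|]cabsE -rmorphM.
move: (cabs _) sl tl hd => l sl tl; rewrite !lt_min => /and4P[le ld1 ld2 ld3].
have {H1} := H1 s; have {H2} := H2 t; have {H3} := H3 t.
rewrite !subr0 expR0 cos0 sin0 oppr0 mul0r !mul1r !subr0 addr0.
move=> /(_ (le_lt_trans tl ld3)) h3 /(_ (le_lt_trans tl ld2)) h2 /(_ (le_lt_trans sl ld1)) h1.
apply: le_trans (normc_ReIm _) _; rewrite lecR /=.
set A := expR s in h1 *; set c := cos t in h2 *; set u := sin t in h3 *.
have A1 : `|A - 1| <= 2 * `|s|.
  have -> : A - 1 = (A - 1 - s) + s by ring.
  rewrite (le_trans (ler_normD _ _)) //; have := ler_wpM2r (normr_ge0 s) e01; lra.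
have A3 : `|A| <= 3.
  have -> : A = (A - 1) + 1 by ring.
  rewrite (le_trans (ler_normD _ _)) // normr1; lra.
have re : `|A * c - 0 * u - 1 - s| <= e0 * `|s| + 3 * (e0 * `|t|).
  have -> : A * c - 0 * u - 1 - s = (A - 1 - s) + A * (c - 1) by ring.
  by rewrite (le_trans (ler_normD _ _)) // lerD // normrM ler_pM.
have im : `|A * u + 0 * c - 0 - t| <= 3 * (e0 * `|t|) + 2 * `|s| * `|t|.
  have -> : A * u + 0 * c - 0 - t = A * (u - t) + (A - 1) * t by ring.
  by rewrite (le_trans (ler_normD _ _)) // !normrM lerD // ler_pM.
rewrite (le_trans (lerD re im)) //.
have st : `|s| * `|t| <= e0 * l by rewrite ler_pM // (le_trans sl) // ltW.
have es : e0 * `|s| <= e0 * l by rewrite ler_wpM2l // ltW.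
have et : e0 * `|t| <= e0 * l by rewrite ler_wpM2l // ltW.
have rl : 9 * e0 * l <= r * l by rewrite ler_wpM2r // (le_trans _ sl).
by lra.
Qed.

Lemma derivable_expC (z : C^o) : derivable (expC : C^o -> C^o) z 1.
Proof.
apply: (@approx_derivable _ _ _ (expC z)) => e e0.
have z0 : 0 < `|expC z| by rewrite norm_expC ltcR expR_gt0.
have [d d0 Hd] := expC_approx0 (divr_gt0 e0 z0); exists d => // h /Hd hh.
rewrite expCD (_ : _ - _ = expC z * (expC h - 1 - h)); last by ring.
by rewrite normrM -ler_pdivlMl // mulrA [_^-1 * e]mulrC.
Qed.

(** By periodicity the horizontal sides of the rectangle cancel, so the integral does not depend on
    the radius; it tends to 0 with the radius by the bound [K |z|]. *)
Lemma circle_integral_eq0 (f : C^o -> C^o) (K r : R) : 0 < r ->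
  (forall z : C, 0 < `|z| < 1 -> derivable f z 1) ->
  (forall z : C, `|z| < r%:C -> `|f z| <= K%:C * `|z|) ->
  forall s : R, s < 0 -> intC 0 (2 * pi) (fun t => f (expC (s +i* t))) = 0.
Proof.
move=> r0 df fK s s0.
have pi0 : 0 <= 2 * pi :> R by rewrite mulr_ge0 // pi_ge0.
pose H : C^o -> C^o := f \o expC.
have dH x t : x < 0 -> derivable H (x +i* t) 1.
  move=> x0; apply/derivable1_diffP; apply: differentiable_comp.
    exact/derivable1_diffP/derivable_expC.
  apply/derivable1_diffP/df; rewrite norm_expC ltcR expR_gt0 /=.
  by rewrite (_ : 1 = 1%:C) // ltcR expR_lt1.
have cancel_i (X V W : C) : X + 'i%C * V - X - 'i%C * W = 0 -> W = V.
  rewrite [_ - X]addrAC subrr add0r -mulrBr => /eqP; rewrite mulf_eq0 subr_eq0.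
  by rewrite eq_complex /= oner_eq0 andbF => /eqP.
have I_const x : x <= s -> intC 0 (2 * pi) (fun t => H (x +i* t)) =
    intC 0 (2 * pi) (fun t => H (s +i* t)).
  move=> xs; have dH' y t : x <= y <= s -> 0 <= t <= 2 * pi -> derivable H (y +i* t) 1.
    by move=> /andP[_ ys] _; apply: dH; apply: le_lt_trans ys s0.
  have := goursat xs pi0 dH'; rewrite /boundary.
  rewrite (_ : intC x s (fun y => H (y +i* (2 * pi))) = intC x s (fun y => H (y +i* 0))).
    by move/cancel_i.
  by apply: eq_intC => y _; rewrite /H /= /expC /= mulr_natl cos2pi sin2pi cos0 sin0.
apply/eqP; rewrite -normr_eq0 eq_le normr_ge0 andbT.
apply/ler_addgt0Pl => _ /pos_normcP[e e0 ->]; rewrite addr0.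
pose K' := `|K| + 1; have K0 : 0 < K' by rewrite ltr_wpDl.
have KK : K <= K' by rewrite (le_trans (ler_norm _)) // lerDl.
have pi1 : 0 < 2 * (2 * pi) :> R by rewrite !mulr_gt0 // pi_gt0.
(* The comparison radius: at most [expR s], inside the disk where the bound on [f] holds, and small
   enough for the integral to be at most [e]. *)
pose d := Num.min (expR s) (Num.min (r / 2) (e / (K' * (2 * (2 * pi))))).
have d0 : 0 < d by rewrite !lt_min expR_gt0 !divr_gt0 // mulr_gt0.
have xd : expR (ln d) = d by apply: lnK.
have xs : ln d <= s by rewrite -ler_expR xd ge_min lexx.
have dr : d < r.
  apply: (@le_lt_trans _ _ (r / 2)); first by rewrite !ge_min lexx !orbT.
  by rewrite ltr_pdivrMr // ltr_pMr // ltr1n.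
rewrite -(I_const _ xs); apply: (@le_trans _ _ (2 * (K' * d) * (2 * pi - 0))%:C).
  apply: norm_intC_le => //.
    move=> t _; apply: (@continuous_comp _ _ _ (fun t => (ln d +i* t : C^o))).
      exact: cts_vertical.
    by apply/derivable_cts/dH; apply: le_lt_trans xs s0.
  move=> t _; have nE : `|expC (ln d +i* t)| = d%:C by rewrite norm_expC /= xd.
  rewrite /H /= (le_trans (fK _ _)) ?nE ?ltcR // -rmorphM lecR.
  by rewrite ler_wpM2r // ltW.
rewrite lecR subr0 (_ : _ * _ = d * (K' * (2 * (2 * pi)))); last by ring.
rewrite -ler_pdivlMr ?mulr_gt0 ?pi_gt0 //.
by rewrite !ge_min lexx !orbT.
Qed.

End CircleIntegral.

(** * Taylor coefficients of Schur functions *)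

Section SchurContraction.
Local Open Scope complex_scope.
Local Open Scope classical_set_scope.
Variable R : realType.
Local Notation C := R[i].

Lemma intC_conj (a b : R) (phi : R -> C) : contC a b phi ->
  intC a b (fun x => (phi x)^*%R) = (intC a b phi)^*%R.
Proof.
move=> cp; have ci := contC_Im cp; rewrite /intC /=.
rewrite (_ : (fun x => complex.Re _) = (fun x => complex.Re (phi x))); last first.
  by apply/funext => x; case: (phi x).
rewrite (_ : (fun x => complex.Im ((phi x)^*%R)) = (fun x => -1 * complex.Im (phi x))).
  by rewrite (intRZ _ ci) mulN1r.
by apply/funext => x; case: (phi x) => u v /=; rewrite mulN1r.
Qed.

Lemma intC_ge0 (a b : R) (phi : R -> C) : a <= b -> contC a b phi ->
  (forall x, a <= x <= b -> 0 <= phi x) -> 0 <= intC a b phi.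
Proof.
move=> ab cp p0; rewrite /intC (_ : intR a b (fun x => complex.Im _) = 0).
  rewrite ler0c -[0](mul0r (b - a)) -intR_cst //; apply: le_intR.
  - by move=> x _; apply: cvg_cst.
  - exact: contC_Re.
  - by move=> x /p0; rewrite lecE /= => /andP[].
rewrite -[RHS](mul0r (b - a)) -intR_cst //; apply: eq_intR => x /p0.
by rewrite lecE /= => /andP[/eqP ->].
Qed.

Lemma contC_sum (a b : R) N (F : nat -> R -> C) : (forall k, contC a b (F k)) ->
  contC a b (fun t => \sum_(k < N) F k t).
Proof.
move=> cF; elim: N => [|N IH].
  rewrite (_ : (fun t => _) = cst 0); first exact: contC_cst.
  by apply/funext => t; rewrite big_ord0.
rewrite (_ : (fun t => _) = (fun t => \sum_(k < N) F k t) \+ F N).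
  exact: (contCD IH (cF N)).
by apply/funext => t; rewrite big_ord_recr.
Qed.

Lemma intC_sum (a b : R) N (F : nat -> R -> C) : a <= b -> (forall k, contC a b (F k)) ->
  intC a b (fun t => \sum_(k < N) F k t) = \sum_(k < N) intC a b (F k).
Proof.
move=> ab cF; elim: N => [|N IH].
  rewrite big_ord0 (_ : (fun t => _) = cst 0); first by rewrite intC_cst // mul0r.
  by apply/funext => t; rewrite big_ord0.
rewrite (_ : (fun t => _) = (fun t => \sum_(k < N) F k t) \+ F N).
  by rewrite (intCD (contC_sum cF) (cF N)) IH big_ord_recr.
by apply/funext => t; rewrite big_ord_recr.
Qed.

Section Circle.
Variable s : R.
Hypothesis s0 : s < 0.
Let rho := expR s.
Let phi (t : R) := expC (s +i* t).

Let pi0 : 0 <= 2 * pi :> R.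
Proof. by rewrite mulr_ge0 // pi_ge0. Qed.

Lemma norm_circle t : `|phi t| = rho%:C.
Proof. exact: norm_expC. Qed.

Lemma circle_neq0 t : phi t != 0.
Proof. by rewrite -normr_gt0 norm_circle ltcR expR_gt0. Qed.

Lemma circle_lt1 t : `|phi t| < 1.
Proof. by rewrite norm_circle (_ : 1 = 1%:C) // ltcR expR_lt1. Qed.

Lemma conj_circle t : (phi t)^*%R = (rho ^+ 2)%:C / phi t.
Proof.
by rewrite rmorphXn /= -(norm_circle t) normCK mulrAC divff ?circle_neq0 // mul1r.
Qed.

Lemma cts_comp_circle (f : C^o -> C^o) :
  (forall z : C, 0 < `|z| < 1 -> derivable f z 1) -> contC 0 (2 * pi) (fun t => f (phi t)).
Proof.
move=> df t _.
apply: (@continuous_comp _ _ _ (fun t => (phi t : C^o))).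
  apply: (@continuous_comp _ _ _ (fun t => (s +i* t : C^o))); first exact: cts_vertical.
  exact/derivable_cts/derivable_expC.
by apply/derivable_cts/df; rewrite normr_gt0 circle_neq0 circle_lt1.
Qed.

Lemma contC_horner (p : {poly C}) : contC 0 (2 * pi) (fun t => p.[phi t]).
Proof. by apply: (cts_comp_circle (f := fun z => p.[z])) => z _; apply: derivable_hornerC. Qed.

Lemma contC_conj_pow k : contC 0 (2 * pi) (fun t => ((phi t)^*%R) ^+ k).
Proof.
rewrite (_ : (fun t => _) = (fun t => (('X^k).[phi t])^*%R)).
  exact/contC_conj/contC_horner.
by apply/funext => t; rewrite hornerXn rmorphXn.
Qed.

Lemma contC_pow k : contC 0 (2 * pi) (fun t => phi t ^+ k).
Proof.
rewrite (_ : (fun t => _) = (fun t => ('X^k).[phi t])); first exact: contC_horner.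
by apply/funext => t; rewrite hornerXn.
Qed.

Lemma contC_monomial j k : contC 0 (2 * pi) (fun t => phi t ^+ j * (phi t)^*%R ^+ k).
Proof. exact: (contCM (@contC_pow j) (@contC_conj_pow k)). Qed.

(** With [conj phi = rho^2 / phi], the integrand is a multiple of [phi^(j-k)], a positive power that
    vanishes at 0. *)
Lemma circle_monomial_gt j k : (k < j)%N ->
  intC 0 (2 * pi) (fun t => phi t ^+ j * (phi t)^*%R ^+ k) = 0.
Proof.
move=> kj; pose m := (j - k)%N.
rewrite (_ : (fun t => _) = (fun t => ((rho ^+ 2)%:C) ^+ k * phi t ^+ m)).
  rewrite (intCZ _ (@contC_pow m)) (@circle_integral_eq0 _ (fun z => z ^+ m) 1 1) ?mulr0 //.
    move=> z _; rewrite (_ : (fun y => _) = (fun y : C^o => ('X^m).[y] : C^o)).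
      exact: derivable_hornerC.
    by apply/funext => y; rewrite hornerXn.
  move=> z z1; rewrite mul1r normrX -(prednK (_ : 0 < m)%N) ?subn_gt0 //.
  by rewrite exprS ler_piMr // exprn_ile1 // ltW.
apply/funext => t; rewrite conj_circle [(_ / phi t) ^+ k]exprMn mulrCA; congr (_ * _).
by rewrite exprVn /m expfB.
Qed.

Lemma circle_monomial j k :
  intC 0 (2 * pi) (fun t => phi t ^+ j * (phi t)^*%R ^+ k)
    = if j == k then (rho ^+ (2 * k) * (2 * pi))%:C else 0.
Proof.
case: (ltngtP j k) => [jk|kj|->]; last 2 first.
- exact: circle_monomial_gt.
- rewrite (_ : (fun t => _) = cst (rho ^+ (2 * k))%:C).
    by rewrite intC_cst // subr0 [RHS]rmorphM.
  apply/funext => t; rewrite -exprMn -normCK norm_circle -exprM.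
  by rewrite rmorphXn.
rewrite (_ : (fun t => _) = (fun t => (phi t ^+ k * (phi t)^*%R ^+ j)^*%R)).
  by rewrite (intC_conj (@contC_monomial k j)) circle_monomial_gt ?rmorph0.
by apply/funext => t; rewrite [RHS]rmorphM !rmorphXn /= conjCK mulrC.
Qed.

Lemma circle_parseval n (p : {poly C}) : (size p <= n.+1)%N ->
  intC 0 (2 * pi) (fun t => p.[phi t] * (p.[phi t])^*%R)
    = \sum_(k < n.+1) `|p`_k| ^+ 2 * (rho ^+ (2 * k) * (2 * pi))%:C.
Proof.
move=> sp.
pose G (j k : nat) t := (p`_j * (p`_k)^*%R) * (phi t ^+ j * (phi t)^*%R ^+ k).
have cG j k : contC 0 (2 * pi) (G j k).
  exact: (contCM (@contC_cst _ _ _ _) (@contC_monomial j k)).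
rewrite (_ : (fun t => _) = (fun t => \sum_(k < n.+1) \sum_(j < n.+1) G j k t)).
  rewrite (intC_sum _ pi0 (F := fun k t => \sum_(j < n.+1) G j k t)); last first.
    by move=> k; apply: (contC_sum (F := fun j t => G j k t)).
  apply: eq_bigr => k _; rewrite (intC_sum _ pi0 (F := fun j t => G j k t)) //.
  rewrite (bigD1 k) //= [X in _ + X]big1 ?addr0 => [|j jk].
    by rewrite (intCZ _ (@contC_monomial _ _)) circle_monomial eqxx normCK.
  by rewrite (intCZ _ (@contC_monomial _ _)) circle_monomial (negPf jk : (j == k :> nat) = false) mulr0.
apply/funext => t; rewrite (horner_coef_wide _ sp) rmorph_sum mulr_sumr.
apply: eq_bigr => k _; rewrite mulr_suml; apply: eq_bigr => j _.
by rewrite /G rmorphM rmorphXn /=; ring.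
Qed.

(* On the circle [conj phi = rho^2 / phi], so pairing [h] with a polynomial of
   degree at most [n] amounts to integrating the functions [h z / z^k]. *)
Lemma circle_orthogonal n (h : C^o -> C^o) (p : {poly C}) (K r : R) : 0 < r ->
  (forall z : C, `|z| < 1 -> derivable h z 1) ->
  (forall z : C, `|z| < r%:C -> `|h z| <= K%:C * `|z| ^+ n.+1) ->
  (size p <= n.+1)%N ->
  intC 0 (2 * pi) (fun t => h (phi t) * (p.[phi t])^*%R) = 0.
Proof.
move=> r0 dh hK sp.
pose f k : C^o -> C^o := fun z => h z / ('X^k).[z].
have df k z : 0 < `|z| < 1 -> derivable (f k) z 1.
  move=> /andP[z0 z1]; apply: derivableM; first exact: dh.
  apply: derivableV; last exact: derivable_hornerC.
  by rewrite hornerXn expf_neq0 // -normr_gt0.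
have If k : (k < n.+1)%N -> intC 0 (2 * pi) (fun t => f k (phi t)) = 0.
  move=> kn; apply: (@circle_integral_eq0 _ (f k) `|K| (Num.min r 1)) => //.
    by rewrite lt_min r0 ltr01.
    by move=> z; apply: df.
  move=> z zr; have {zr} [zr z1] : `|z| < r%:C /\ `|z| < 1.
    have : cabs z < Num.min r 1 by rewrite -ltcR -cabsE.
    rewrite lt_min => /andP[zr1 z1]; rewrite cabsE ltcR; split=> //.
    by rewrite (_ : 1 = 1%:C) // ltcR.
  rewrite /f hornerXn normrM normfV normrX.
  (* At the origin the bound forces [h 0 = 0], so the quotient is 0 there whatever the
     denominator. *)
  have [->|z0] := eqVneq z 0.
    have h0 : `|h 0| <= 0 by rewrite (le_trans (hK _ _)) ?normr0 ?ltcR // expr0n mulr0.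
    by rewrite normr0 mulr0 (le_trans (ler_wpM2r _ h0)) ?mul0r // invr_ge0 exprn_ge0.
  rewrite ler_pdivrMr ?exprn_gt0 ?normr_gt0 // (le_trans (hK _ zr)) //.
  rewrite -mulrA -exprS; apply: (@le_trans _ _ (`|K|%:C * `|z| ^+ n.+1)).
    by rewrite ler_wpM2r ?exprn_ge0 // lecR ler_norm.
  by rewrite ler_wpM2l ?ler0c // ler_wiXn2l // ltW.
pose G (k : nat) t := ((p`_k)^*%R * (rho ^+ 2)%:C ^+ k) * f k (phi t).
have cf k := cts_comp_circle (df k).
have cG k : contC 0 (2 * pi) (G k) by exact: (contCM (@contC_cst _ _ _ _) (cf k)).
rewrite (_ : (fun t => _) = (fun t => \sum_(k < n.+1) G k t)).
  rewrite (intC_sum _ pi0 cG) big1 // => k _.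
  by rewrite (intCZ _ (cf k)) If // mulr0.
apply/funext => t; rewrite (horner_coef_wide _ sp) rmorph_sum mulr_sumr.
apply: eq_bigr => k _; rewrite /G /f hornerXn rmorphM rmorphXn /=.
by rewrite -/(phi t) conj_circle exprMn exprVn; ring.
Qed.

End Circle.

End SchurContraction.

(** * Bessel's inequality for multiplication by a Schur function *)

Section SchurBessel.
Local Open Scope complex_scope.
Local Open Scope classical_set_scope.
Variable R : realType.
Local Notation C := R[i].

(** Write [f g = r + h] with [h] vanishing to order [n+1]. On the circle of radius [expR s], [h] is
    orthogonal to [r], and [|f| <= 1] gives the comparison with [g]. *)
Lemma circle_sum_le n (f : C^o -> C^o) (g r : {poly C}) (K d s : R) :
  schur_class f -> (size g <= n.+1)%N -> (size r <= n.+1)%N -> 0 < d ->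
  (forall z : C, `|z| < d%:C -> `|f z * g.[z] - r.[z]| <= K%:C * `|z| ^+ n.+1) ->
  s < 0 ->
  \sum_(k < n.+1) `|r`_k| ^+ 2 * (expR s ^+ (2 * k) * (2 * pi))%:C
    <= \sum_(k < n.+1) `|g`_k| ^+ 2 * (expR s ^+ (2 * k) * (2 * pi))%:C.
Proof.
move=> [df f1] sg sr d0 fK s0.
have pi0 : 0 <= 2 * pi :> R by rewrite mulr_ge0 // pi_ge0.
pose phi (t : R) := expC (s +i* t).
pose h : C^o -> C^o := fun z => f z * g.[z] - r.[z].
have dh z : `|z| < 1 -> derivable h z 1.
  move=> z1; apply: derivableB; last exact: derivable_hornerC.
  by apply: derivableM; [exact: df | exact: derivable_hornerC].
have orth := circle_orthogonal s0 d0 dh fK sr.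
have cf : contC 0 (2 * pi) (fun t => f (phi t)).
  by apply: (cts_comp_circle s0) => z /andP[_]; apply: df.
have ch : contC 0 (2 * pi) (fun t => h (phi t)).
  by apply: (cts_comp_circle s0) => z /andP[_]; apply: dh.
have cg : contC 0 (2 * pi) (fun t => g.[phi t]) by apply: contC_horner s0 _.
have cr : contC 0 (2 * pi) (fun t => r.[phi t]) by apply: contC_horner s0 _.
pose gg t := g.[phi t] * (g.[phi t])^*%R; pose rr t := r.[phi t] * (r.[phi t])^*%R.
pose hr t := h (phi t) * (r.[phi t])^*%R; pose rh t := (hr t)^*%R.
have cgg : contC 0 (2 * pi) gg by apply: contCM (contC_conj _).
have crr : contC 0 (2 * pi) rr by apply: contCM (contC_conj _).
have chr : contC 0 (2 * pi) hr by apply: contCM (contC_conj _).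
have crh : contC 0 (2 * pi) rh by apply: contC_conj.
have cdiff := contCB cgg crr; have cross := contCD chr crh.
rewrite -(circle_parseval s0 sg) -(circle_parseval s0 sr) -/gg -/rr.
(* Subtracting the cross terms, whose integral is 0, makes the integrand pointwise nonnegative. *)
suff: 0 <= intC 0 (2 * pi) (gg \- rr) - intC 0 (2 * pi) (hr \+ rh).
  rewrite (intCB cgg crr) (intCD chr crh) (intC_conj chr).
  by rewrite (_ : intC _ _ hr = 0) // rmorph0 addr0 subr0 subr_ge0.
rewrite -(intCB cdiff cross).
apply: (intC_ge0 pi0 (contCB cdiff cross)).
move=> t _ /=; have -> : gg t - rr t - (hr t + rh t) =
   (1 - `|f (phi t)| ^+ 2) * `|g.[phi t]| ^+ 2 + `|h (phi t)| ^+ 2.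
  rewrite /gg /rr /hr /rh /h !normCK.
  by rewrite !(rmorphB, rmorphM) /= conjCK; ring.
rewrite addr_ge0 ?exprn_ge0 // mulr_ge0 ?exprn_ge0 // subr_ge0 expr_le1 //.
exact/f1/circle_lt1.
Qed.

(** The weighted inequalities on circles are passed to the limit as the radius tends to 1. *)
Lemma schur_sqn_le n (f : C^o -> C^o) (g r : {poly C}) (K d : R) :
  schur_class f -> (size g <= n.+1)%N -> (size r <= n.+1)%N -> 0 < d ->
  (forall z : C, `|z| < d%:C -> `|f z * g.[z] - r.[z]| <= K%:C * `|z| ^+ n.+1) ->
  sqn n r <= sqn n g.
Proof.
move=> fS sg sr d0 fK; have ineq s := circle_sum_le fS sg sr d0 fK (s := s).
have sqn_ge0 (p : {poly C}) : 0 <= sqn n p by apply: sumr_ge0 => i _; rewrite exprn_ge0.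
have [x x0 xE] : exists2 x : R, 0 <= x & sqn n r = x%:C.
  have := sqn_ge0 r; case: (sqn n r) => x y; rewrite lecE /= => /andP[/eqP -> x0].
  by exists x.
have [y y0 yE] : exists2 y : R, 0 <= y & sqn n g = y%:C.
  have := sqn_ge0 g; case: (sqn n g) => u v; rewrite lecE /= => /andP[/eqP -> u0].
  by exists u.
have low s : s < 0 -> x * (expR s ^+ (2 * n)) <= y.
  move=> s0; have pi0 : 0 < 2 * pi :> R by rewrite mulr_gt0 // pi_gt0.
  rewrite -(ler_pM2r pi0) -lecR -mulrA rmorphM /= -xE [(y * _)%:C]rmorphM /= -yE.
  have e01 : expR s <= 1 by rewrite ltW // expR_lt1.
  apply: (@le_trans _ _ (\sum_(k < n.+1) `|r`_k| ^+ 2 * (expR s ^+ (2 * k) * (2 * pi))%:C)).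
    rewrite mulr_suml; apply: ler_sum => k _; rewrite ler_wpM2l ?exprn_ge0 //.
    rewrite lecR ler_wpM2r ?(ltW pi0) // ler_wiXn2l ?expR_ge0 //.
    by rewrite leq_mul2l leq_ord.
  apply: (le_trans (ineq _ s0)); rewrite mulr_suml; apply: ler_sum => k _.
  rewrite ler_wpM2l ?exprn_ge0 // lecR ler_piMl ?(ltW pi0) //.
  by rewrite exprn_ile1 ?expR_ge0.
rewrite xE yE lecR; apply/ler_addgt0Pl => e e0.
(* At [s = - e / N], Bernoulli's bound [expR s ^ (2n) >= 1 - 2n e / N] costs at most [e] after
   multiplication by [x]; the added 1 keeps [N] positive. *)
pose N : R := (2 * n)%:R * x + 1.
have N0 : 0 < N by rewrite ltr_wpDl // mulr_ge0.
have s0 : - (e / N) < 0 by rewrite oppr_lt0 divr_gt0.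
have ex : 1 + (2 * n)%:R * - (e / N) <= expR (- (e / N)) ^+ (2 * n).
  by rewrite -expRM_natl expR_ge1Dx.
have h1 := le_trans (ler_wpM2l x0 ex) (low _ s0).
have h2 : (2 * n)%:R * x * (e / N) <= e.
  by rewrite mulrA ler_pdivrMr // mulrC ler_wpM2l ?(ltW e0) // lerDl.
move: h1 h2; set q := e / N; set m := _%:R; move: q m => q m; clear; lra.
Qed.

End SchurBessel.

(** * Necessity: bounding the number of negative eigenvalues *)

Section BlaschkeNecessity.
Local Open Scope complex_scope.
Local Open Scope classical_set_scope.
Variable R : realType.
Local Notation C := R[i].

Lemma takagi_necessary n kappa (w : {poly C}) (f B : C^o -> C^o) :
  schur_class f -> blaschke_product kappa B ->
  (fun z => B z * w.[z]) = f +O_ (0 : C^o) (fun z => z ^+ n.+1) ->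
  (num_neg_eigenvalues
    (1%:M - (toeplitz_upper n w)^t* *m toeplitz_upper n w) <= kappa)%N.
Proof.
move=> fS /blaschke_productP[gamma [s [gamma1 ss s1 BE]]] /eqaddOP/bigO_exP[k k0 Hk].
rewrite num_neg_toeplitz.
have [M HM] := blaschke_isometry n s.
set T := toeplitz_upper n w.
(* The isometry conditions, one per zero of [B], are imposed on the image [x T]. *)
rewrite -ss; apply: (num_neg_le (M := T *m M)) => x; rewrite mulmxA => xM.
have [v Ev /(_ xM) vE] := HM (x *m T).
rewrite !sqrow_rVpoly -vE.
(* Truncation keeps the norm and provides the degree bound required of the Taylor polynomial
   [gamma v'] of [f p]. *)
set p := rVpoly x; pose v' := take_poly n.+1 v.
have [h hE] : eqmodX n.+1 (inner_num s * (w * p)) (inner_den s * v').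
  apply: eqmodX_trans (eqmodXMl _ (eqmodX_sym (rVpoly_toeplitz w x))) _.
  by apply: eqmodX_trans Ev _; apply/eqmodXMl/eqmodX_take.
have -> : sqn n v = sqn n (gamma *: v').
  by rewrite sqnZ gamma1 expr1n mul1r; apply/sqn_eqmodX/eqmodX_take.
have den0 : (inner_den s).[0] != 0 by apply: inner_den_neq0 => //; rewrite normr0.
have [M1 M10 HM1] := ratio_bounded_near0 h den0.
(* The polynomial [p] is bounded near 0 as the ratio [p / 1]. *)
have [M2 M20 HM2] : exists2 M : C, 0 < M & \forall z \near (0 : C^o), `|p.[z] / (1 : {poly C}).[z]| <= M.
  by apply: ratio_bounded_near0; rewrite hornerC oner_neq0.
have /pos_normcP[K K0 KE] : 0 < k * M2 + M1 by rewrite addr_gt0 // mulr_gt0.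
have : \forall z \near (0 : C^o),
    `|f z * p.[z] - (gamma *: v').[z]| <= K%:C * `|z| ^+ n.+1.
  near=> z; have z1 : `|z| < 1 by near: z; exact: near_unit_disk.
  have dz : (inner_den s).[z] != 0 by apply: inner_den_neq0.
  have {}hE : (inner_num s).[z] * (w.[z] * p.[z]) =
      (inner_den s).[z] * v'.[z] + h.[z] * z ^+ n.+1.
    by have := congr1 (horner^~ z) hE; rewrite /= hornerD !hornerM hornerXn.
  (* The error splits into the interpolation error times [p] and the truncation error of [B w p];
     both are of order [z^(n+1)]. *)
  have -> : f z * p.[z] - (gamma *: v').[z] = - ((B z * w.[z] - f z) * p.[z])
      + gamma * (h.[z] / (inner_den s).[z] * z ^+ n.+1).
    rewrite hornerZ BE // [h.[z] / _ * _]mulrAC.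
    have -> : h.[z] * z ^+ n.+1 =
      (inner_num s).[z] * (w.[z] * p.[z]) - (inner_den s).[z] * v'.[z].
      by rewrite hE addrC addKr.
    by field.
  rewrite (le_trans (ler_normD _ _)) // normrN !normrM gamma1 mul1r -KE mulrDl.
  rewrite normrX lerD //.
    rewrite mulrAC; apply: ler_pM => //.
      by have : `|B z * w.[z] - f z| <= k * `|z ^+ n.+1|; [near: z; exact: Hk | rewrite normrX].
    by have : `|p.[z] / (1 : {poly C}).[z]| <= M2; [near: z | rewrite hornerC divr1].
  by rewrite -normrM ler_wpM2r ?exprn_ge0 //; near: z.
move=> /nbhs_norm0P[_ /pos_normcP[d d0 ->] Hd].
apply: (schur_sqn_le fS _ _ d0 Hd); first exact: size_poly.
exact: leq_trans (size_scale_leq _ _) (size_take_poly _ _).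
Unshelve. all: by end_near. Qed.

End BlaschkeNecessity.

Theorem theorem3p3 (R : realType) (n kappa : nat) (w : {poly R[i]})
    (hw : (size w <= n.+1)%N) (hkappa : (kappa <= n.+1)%N) :
  let T : 'M[R[i]]_n.+1 := toeplitz_upper n w in
  (num_neg_eigenvalues (1%:M - T ^t* *m T) = kappa ->
     exists f B : R[i]^o -> R[i]^o,
       [/\ schur_class f, blaschke_product kappa B
         & (fun z => B z * w.[z]) = f +O_ (0 : R[i]^o) (fun z => z ^+ n.+1)])
  /\
  ((exists f B : R[i]^o -> R[i]^o,
       [/\ schur_class f, blaschke_product kappa B
         & (fun z => B z * w.[z]) = f +O_ (0 : R[i]^o) (fun z => z ^+ n.+1)]) ->
     (num_neg_eigenvalues (1%:M - T ^t* *m T) <= kappa)%N).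
Proof.
split; first exact: takagi_exists.
by case=> f [B [fS BB E]]; apply: takagi_necessary fS BB E.
Qed.
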